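(* Let $x \in \mathbb{R}\setminus\mathbb{Z}_{\leqslant -1}$, $z\in\mathbb{R}\setminus \mathbb{Z}_{\leqslant 0}$, $m \in \mathbb{N}$ and $n\in\mathbb{Z}_{\geqslant 0}$. Then \[ \begin{aligned} \sum_{k=0}^{\infty}\frac{H_k}{(n+k+1)^{m+1}\binom{n+k}{k}} &=\frac{(-1)^n}{2}\sum_{k=1}^{n}\frac{(-1)^{k-1}}{k^m}\binom{n}{k}\left(H_{n-k}^2+H_{n-k}^{(2)}-H_n^{(2)}-H_n^2\right)\\ &\quad-\frac{(-1)^{m+n}}{2\,m!}\,\frac{\partial^2}{\partial x^2}\left\{\frac{\partial^m}{\partial z^m}\frac{\Gamma(x+1)\Gamma(z)}{\Gamma(z+x)}\right\}\bigg|_{x=n,\,z=1}\\ &\quad+\frac{(-1)^{m+n}H_n}{m!}\,\frac{\partial}{\partial x}\left\{\frac{\partial^m}{\partial z^m}\frac{\Gamma(x+1)\Gamma(z)}{\Gamma(z+x)}\right\}\bigg|_{x=n,\,z=1}. \end{aligned} \]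
   Context: $\Gamma$ is Euler's gamma function. $H_n^{(s)}=\sum_{j=1}^{n}j^{-s}$ are the generalized harmonic numbers, $H_n=H_n^{(1)}$, and $H_0^{(s)}=H_0=0$ (empty sums are zero). $\binom{a}{b}$ denotes the usual binomial coefficient, $\binom{s}{t}=\frac{\Gamma(s+1)}{\Gamma(t+1)\Gamma(s-t+1)}$. $\mathbb{N}=\{1,2,\dots\}$. *)

(* Defs.v *)
From Stdlib Require Import Reals Factorial Lra Lia.
From Coquelicot Require Import Coquelicot.
Open Scope R_scope.

(* Euler's limit N! N^x / (x (x+1) ... (x+N)), which defines Gamma at once on
   all of R \ {0, -1, -2, ...}, negative non-integers included.  The values at
   the poles and the term N = 0 (where 0^x is [Rpower 0 x]) are irrelevant. *)
Definition Gamma (x : R) : R :=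
  real (Lim_seq (fun N : nat =>
    INR (fact N) * Rpower (INR N) x / prod_f_R0 (fun j => x + INR j) N)).

Definition binom (s t : R) : R :=
  Gamma (s + 1) / (Gamma (t + 1) * Gamma (s - t + 1)).

(* [sum_n_m] is zero when the upper bound is below the lower one. *)
Definition gharm (s n : nat) : R := sum_n_m (fun j : nat => / INR j ^ s) 1 n.

Definition harm (n : nat) : R := gharm 1 n.

Definition dzGammaQuot (m : nat) (x z : R) : R :=
  Derive_n (fun w => Gamma (x + 1) * Gamma w / Gamma (w + x)) m z.

Lemma Gamma_fact (n : nat) : Gamma (INR n + 1) = INR (fact n).
Proof.
unfold Gamma.
assert (Hprod : forall N, prod_f_R0 (fun j => INR n + 1 + INR j) N
                          = INR (fact (n + 1 + N)) / INR (fact n)).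
{ induction N as [|N IH].
  - simpl. replace (n + 1 + 0)%nat with (S n) by lia.
    rewrite fact_simpl, mult_INR, S_INR. field. apply INR_fact_neq_0.
  - change (prod_f_R0 (fun j => INR n + 1 + INR j) N * (INR n + 1 + INR (S N))
            = INR (fact (n + 1 + S N)) / INR (fact n)).
    rewrite IH. replace (n + 1 + S N)%nat with (S (n + 1 + N)) by lia.
    rewrite fact_simpl, mult_INR, !S_INR, !plus_INR, INR_1.
    field. apply INR_fact_neq_0. }
assert (Hlim : forall p, is_lim_seq
  (fun N => INR (fact N) * INR N ^ p / INR (fact (p + N))) 1).
{ induction p as [|p IH].
  - apply is_lim_seq_ext with (fun _ => 1).
    + intro N. simpl. field. apply INR_fact_neq_0.
    + apply is_lim_seq_const.
  - apply is_lim_seq_ext with (fun N =>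
      (INR (fact N) * INR N ^ p / INR (fact (p + N))) *
      (1 - INR (S p) * / (INR (N + S p)))).
    + intro N. replace (S p + N)%nat with (S (p + N)) by lia.
      rewrite fact_simpl, mult_INR, <- tech_pow_Rmult, !S_INR, !plus_INR, S_INR.
      pose proof (pos_INR p). pose proof (pos_INR N).
      field. split; [apply INR_fact_neq_0 | lra].
    + replace 1 with (1 * (1 - INR (S p) * 0)) at 1 by ring.
      apply is_lim_seq_mult'; [exact IH|].
      apply is_lim_seq_minus'; [apply is_lim_seq_const|].
      apply is_lim_seq_mult'; [apply is_lim_seq_const|].
      apply (is_lim_seq_incr_n (fun N => / INR N) (S p)).
      replace (Finite 0) with (Rbar_inv p_infty) by reflexivity.
      apply is_lim_seq_inv; [apply is_lim_seq_INR | discriminate]. }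
rewrite (is_lim_seq_unique _ (Finite (INR (fact n)))); [reflexivity|].
apply is_lim_seq_ext_loc with (fun N =>
  INR (fact n) * (INR (fact N) * INR N ^ (n + 1) / INR (fact (n + 1 + N)))).
- exists 1%nat. intros N HN. rewrite Hprod.
  replace (INR n + 1) with (INR (n + 1)) by (rewrite plus_INR, INR_1; ring).
  rewrite Rpower_pow by (apply lt_0_INR; lia).
  field. split; apply INR_fact_neq_0.
- replace (Finite (INR (fact n))) with (Finite (INR (fact n) * 1))
    by (f_equal; ring).
  apply is_lim_seq_mult'; [apply is_lim_seq_const | apply Hlim].
Qed.

Lemma binom_nat (n k : nat) :
  (k <= n)%nat -> binom (INR n) (INR k) = Binomial.C n k.
Proof.
intro Hk. unfold binom, Binomial.C.
rewrite <- minus_INR by exact Hk. now rewrite !Gamma_fact.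
Qed.

(* Main.v *)
Require Import Defs.
From Stdlib Require Import Reals Factorial Lra Lia.
From Coquelicot Require Import Coquelicot.
Open Scope R_scope.

(** Write [b_k(x) = (-1)^k binom(x,k)].  For [x], [w], [w+x > -1],
      [Gamma(x+1) Gamma(w+1) / Gamma(w+x+1) = 1 + sum_{k>=1} b_k(x) w / (w+k)]:
    both sides satisfy the same first-order recurrences in [w] and in [x], and
    for [x] near 0 the right-hand side is monotone in [w], which pins down its
    growth as [w -> oo].  Hence the [m]-th derivative in [z] at [z = w+1 = 1] is
      [- (-1)^m m! sum_{k>=1} b_k(x) / k^m].
    At [x = n + e] the terms with [k <= n] are
      [b_k = (-1)^k binom(n,k) prod_{i<k} (1 + e/(n-i))],
    and those with [k = n+1+j] carry a factor [e]:
      [b_k = - (-1)^n e prod_{i<=n} (1 + e/i) prod_{i<=j} (1 - e/i)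
             / (binom(n+j,j) (n+j+1))].
    Differentiating termwise in [e] at 0, the former produce the finite sum of
    the theorem, and the latter the series weighted by [H_n - H_j]; the term
    with [H_n] times the first derivative leaves [H_j]. *)

(** * Termwise differentiation of series *)

Lemma ex_series_bounded (a : nat -> R) (M : R) :
  (forall k, 0 <= a k) -> (forall N, sum_n a N <= M) -> ex_series a.
Proof.
intros Ha HM.
destruct (ex_finite_lim_seq_incr (sum_n a) M) as [l Hl]; [|exact HM|].
- intro N. rewrite sum_Sn. unfold plus; simpl. specialize (Ha (S N)). lra.
- now exists l.
Qed.

Lemma ex_series_dominated (a b : nat -> R) :
  (forall k, Rabs (a k) <= b k) -> ex_series b -> ex_series a.
Proof. intros H Hb. exact (ex_series_le a b H Hb). Qed.

(** The finite part runs from 1 with [k - 1], because the coefficient of index [k] will be stored as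
    [sbin x (S (k - 1))]; this lines it up with the finite sum of the theorem. *)
Lemma Series_split_first (a : nat -> R) (n : nat) : ex_series a ->
  Series a = sum_n_m (fun k => a (k - 1)%nat) 1 n
             + Series (fun j => a (n + j)%nat).
Proof.
intro Ha. induction n as [|n IH].
- rewrite sum_n_m_zero by lia. unfold zero; simpl. rewrite Rplus_0_l.
  now apply Series_ext.
- rewrite sum_n_Sm by lia. unfold plus; simpl.
  rewrite IH, (Series_incr_1 (fun j => a (n + j)%nat)).
  + rewrite Nat.add_0_r, Nat.sub_0_r, Rplus_assoc. f_equal. f_equal.
    apply Series_ext. intro k. f_equal. lia.
  + now apply (ex_series_incr_n a n).
Qed.

Lemma Series_ge0 (a : nat -> R) : (forall k, 0 <= a k) -> ex_series a ->
  0 <= Series a.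
Proof.
intros Ha Hs.
replace 0 with (Series (fun k => 0 * a k)) by (rewrite Series_scal_l; ring).
apply Series_le; [intro k; specialize (Ha k); lra | exact Hs].
Qed.

Section TermwiseDerivative.

Variables (u u1 u2 : nat -> R -> R) (M : nat -> R) (x0 r : R).
Hypothesis Hr : 0 < r.
Hypothesis Hu : forall k x, Rabs (x - x0) < r -> is_derive (u k) x (u1 k x).
Hypothesis Hu1 : forall k x, Rabs (x - x0) < r -> is_derive (u1 k) x (u2 k x).
Hypothesis HM : forall k x, Rabs (x - x0) < r -> Rabs (u2 k x) <= M k.
Hypothesis HMs : ex_series M.
Hypothesis Hus : forall x, Rabs (x - x0) < r -> ex_series (fun k => u k x).
Hypothesis Hu1s : ex_series (fun k => u1 k x0).

(** The intermediate point is located only by its distance to [x0], which is enough to apply the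
    mean value theorem a second time at [c]. *)
Lemma MVT_ball (f df : R -> R) (y : R) :
  (forall x, Rabs (x - x0) < r -> is_derive f x (df x)) ->
  Rabs (y - x0) < r ->
  exists c, Rabs (c - x0) <= Rabs (y - x0) /\ f y - f x0 = df c * (y - x0).
Proof.
intros Hf Hy.
assert (Hin : forall x, Rmin x0 y <= x <= Rmax x0 y ->
                        Rabs (x - x0) <= Rabs (y - x0)).
{ intros x [H1 H2]. unfold Rmin, Rmax in *.
  destruct (Rle_dec x0 y); unfold Rabs;
  destruct (Rcase_abs (x - x0)), (Rcase_abs (y - x0)); lra. }
destruct (MVT_gen f x0 y df) as [c [Hc He]].
- intros x Hx. apply Hf. apply Rle_lt_trans with (2 := Hy), Hin. lra.
- intros x Hx. apply continuity_pt_filterlim. apply (ex_derive_continuous f x).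
  exists (df x). apply Hf. apply Rle_lt_trans with (2 := Hy), Hin, Hx.
- exists c. split; [now apply Hin | exact He].
Qed.

(** Two mean values: [u k y - u k x0 = u1 k c * (y - x0)], then
    [u1 k c - u1 k x0 = u2 k c' * (c - x0)] with [c] no farther from [x0] than [y]. This loses the
    factor 1/2 of Taylor's formula. *)
Lemma taylor1_remainder (k : nat) (y : R) : Rabs (y - x0) < r ->
  Rabs (u k y - u k x0 - (y - x0) * u1 k x0) <= M k * (y - x0) ^ 2.
Proof.
intro Hy.
destruct (MVT_ball (u k) (u1 k) y (Hu k) Hy) as [c [Hc He]].
assert (Hc' : Rabs (c - x0) < r) by lra.
destruct (MVT_ball (u1 k) (u2 k) c (Hu1 k) Hc') as [c' [Hc'' He']].
replace (u k y - u k x0 - (y - x0) * u1 k x0)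
  with (u2 k c' * ((c - x0) * (y - x0)))
  by (rewrite He; replace (u1 k c) with (u1 k x0 + u2 k c' * (c - x0)) by lra;
      ring).
rewrite !Rabs_mult, <- pow2_abs. simpl. rewrite Rmult_1_r.
assert (Rabs (u2 k c') <= M k) by (apply HM; lra).
apply Rmult_le_compat; try apply Rabs_pos; auto.
- apply Rmult_le_pos; apply Rabs_pos.
- apply Rmult_le_compat_r; [apply Rabs_pos | exact Hc].
Qed.

(* By Taylor's formula the error of the difference quotient is at most
   [|h| * sum M]. *)
Lemma is_derive_Series :
  is_derive (fun x => Series (fun k => u k x)) x0 (Series (fun k => u1 k x0)).
Proof.
apply is_derive_Reals. intros eps Heps.
assert (HM0 : forall k, 0 <= M k).
{ intro k. apply Rle_trans with (Rabs (u2 k x0)); [apply Rabs_pos|].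
  apply HM. now rewrite Rminus_eq_0, Rabs_R0. }
assert (HS0 := Series_ge0 M HM0 HMs).
(* Adding 1 to [Series M] keeps the quotient meaningful when the majorant sums to 0. *)
assert (Hd : 0 < Rmin r (eps / (Series M + 1))).
{ apply Rmin_pos; [exact Hr | apply Rdiv_lt_0_compat; lra]. }
exists (mkposreal _ Hd). simpl. intros h Hh Hlt.
assert (Hx : Rabs (x0 + h - x0) < r).
{ replace (x0 + h - x0) with h by ring.
  apply Rlt_le_trans with (1 := Hlt), Rmin_l. }
assert (Hx0 : Rabs (x0 - x0) < r) by now rewrite Rminus_eq_0, Rabs_R0.
assert (E : Series (fun k => u k (x0 + h)) - Series (fun k => u k x0)
            - h * Series (fun k => u1 k x0)
          = Series (fun k => u k (x0 + h) - u k x0 - h * u1 k x0)).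
{ rewrite <- Series_scal_l.
  rewrite Series_minus, Series_minus; auto.
  - apply (ex_series_minus (fun k => u k (x0 + h)) (fun k => u k x0)); auto.
  - exact (ex_series_scal h _ Hu1s). }
assert (B : Rabs (Series (fun k => u k (x0 + h)) - Series (fun k => u k x0)
            - h * Series (fun k => u1 k x0)) <= h ^ 2 * Series M).
{ rewrite E, <- Series_scal_l.
  assert (T : forall k, Rabs (u k (x0 + h) - u k x0 - h * u1 k x0)
                        <= h ^ 2 * M k).
  { intro k. pose proof (taylor1_remainder k (x0 + h) Hx) as T.
    replace (x0 + h - x0) with h in T by ring. lra. }
  assert (TS : ex_series (fun k => h ^ 2 * M k))
    by exact (ex_series_scal (h ^ 2) _ HMs).
  apply Rle_trans with (1 := Series_Rabs _
    (ex_series_le (fun k => Rabs (u k (x0 + h) - u k x0 - h * u1 k x0)) _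
     (fun k => eq_ind_r (fun t => t <= _) (T k) (Rabs_Rabsolu _)) TS)).
  apply Series_le; [intro k; split; [apply Rabs_pos | apply T] | exact TS]. }
replace ((Series (fun k => u k (x0 + h)) - Series (fun k => u k x0)) / h
         - Series (fun k => u1 k x0))
  with ((Series (fun k => u k (x0 + h)) - Series (fun k => u k x0)
            - h * Series (fun k => u1 k x0)) / h) by (field; exact Hh).
assert (Hp := Rabs_pos_lt h Hh).
unfold Rdiv. rewrite Rabs_mult, Rabs_inv.
apply (Rmult_lt_reg_r (Rabs h)); [exact Hp|].
rewrite Rmult_assoc, Rinv_l, Rmult_1_r by lra.
apply Rle_lt_trans with (1 := B). rewrite <- pow2_abs. simpl.
assert (Hl : Rabs h < eps / (Series M + 1))
  by (apply Rlt_le_trans with (1 := Hlt), Rmin_r).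
apply (Rmult_lt_compat_r (Series M + 1)) in Hl; [|lra].
unfold Rdiv in Hl. rewrite Rmult_assoc, Rinv_l in Hl by lra. nra.
Qed.

End TermwiseDerivative.

(** * Derivatives of finite products of linear factors *)

(* [dprod c k p] is the [p]-th derivative of [x |-> prod_{i<k} (1 + c i * x)]. *)
Fixpoint dprod (c : nat -> R) (k p : nat) (x : R) : R :=
  match k with
  | O => match p with O => 1 | S _ => 0 end
  | S k => dprod c k p x * (1 + c k * x) + INR p * c k * dprod c k (p - 1) x
  end.

(** Leibniz's rule against a linear factor has only two terms, which is the recursion of [dprod]; at
    [p = 0] the truncated [p - 1] is multiplied by [INR 0]. *)
Lemma is_derive_dprod (c : nat -> R) (k p : nat) (x : R) :
  is_derive (dprod c k p) x (dprod c k (S p) x).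
Proof.
revert p. induction k as [|k IH]; intro p.
- apply (is_derive_ext (fun _ => dprod c 0 p 0)); [now destruct p|].
  apply (is_derive_const (dprod c 0 p 0) x).
- change (is_derive (fun y => dprod c k p y * (1 + c k * y)
                              + INR p * c k * dprod c k (p - 1) y) x
    (dprod c k (S p) x * (1 + c k * x)
     + INR (S p) * c k * dprod c k (S p - 1) x)).
  assert (E : INR p * c k * dprod c k (S (p - 1)) x = INR p * c k * dprod c k p x).
  { destruct p; [simpl; ring|]. do 2 f_equal. lia. }
  replace (dprod c k (S p) x * (1 + c k * x)
     + INR (S p) * c k * dprod c k (S p - 1) x)
    with (dprod c k (S p) x * (1 + c k * x) + dprod c k p x * c k
          + INR p * c k * dprod c k (S (p - 1)) x).
  2: { rewrite E, S_INR. replace (S p - 1)%nat with p by lia. ring. }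
  apply (is_derive_plus (fun y => dprod c k p y * (1 + c k * y))
           (fun y => INR p * c k * dprod c k (p - 1) y)).
  + apply (is_derive_mult (dprod c k p) (fun y => 1 + c k * y)).
    * apply IH.
    * auto_derive; [trivial | ring].
    * intros; apply Rmult_comm.
  + apply (is_derive_scal (dprod c k (p - 1))), IH.
Qed.

(** These are the first two terms of the binomial expansion, matching the two terms of the recursion
    of [dprod]. *)
Lemma pow_add_ge (s t : R) (p : nat) : 0 <= s -> 0 <= t ->
  s ^ p + INR p * t * s ^ (p - 1) <= (s + t) ^ p.
Proof.
intros Hs Ht. induction p as [|p IH]; [simpl; lra|].
rewrite S_INR. replace (S p - 1)%nat with p by lia. simpl (_ ^ S p).
apply Rle_trans with ((s + t) * (s ^ p + INR p * t * s ^ (p - 1))).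
2: apply Rmult_le_compat_l; lra.
pose proof (pos_INR p). pose proof (pow_le s (p - 1) Hs).
destruct p as [|p]; [simpl; lra|].
replace (S p - 1)%nat with p in * by lia. simpl (s ^ S p).
assert (0 <= t * t * INR (S p) * s ^ p) by (repeat apply Rmult_le_pos; auto).
nra.
Qed.

(** With [A] the product of the [1 + |c i| r] and [s] the sum of the [|c i|] (the first derivative
    at 0), the [p]-th derivative is at most [A s^p]. The inequality [r s <= A - 1] later trades each
    [s] for a multiple of [A]. *)
Lemma dprod_bound (c : nat -> R) (r x : R) (k p : nat) : Rabs x <= r ->
  Rabs (dprod c k p x) <=
    dprod (fun i => Rabs (c i)) k 0 r * dprod (fun i => Rabs (c i)) k 1 0 ^ p
  /\ 1 <= dprod (fun i => Rabs (c i)) k 0 r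
  /\ r * dprod (fun i => Rabs (c i)) k 1 0 <= dprod (fun i => Rabs (c i)) k 0 r - 1
  /\ 0 <= dprod (fun i => Rabs (c i)) k 1 0
  /\ dprod (fun i => Rabs (c i)) k 0 0 = 1.
Proof.
intro Hx. assert (Hr : 0 <= r) by (pose proof (Rabs_pos x); lra).
revert p. induction k as [|k IH]; intro p.
- simpl. repeat split; try lra. destruct p; simpl; rewrite ?Rabs_R1, ?Rabs_R0; lra.
- cbn [dprod]. rewrite !Rmult_0_r, !Rplus_0_r. simpl INR. simpl (1 - 1)%nat.
  destruct (IH 0%nat) as [_ [HA [HS [HS0 H00]]]]. rewrite H00.
  set (A := dprod (fun i => Rabs (c i)) k 0 r) in *.
  set (s := dprod (fun i => Rabs (c i)) k 1 0) in *.
  pose proof (Rabs_pos (c k)) as Hc. set (t := Rabs (c k)) in *.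
  rewrite !Rmult_0_l, !Rplus_0_r, !Rmult_1_r, !Rmult_1_l.
  assert (0 <= t * r) by nra.
  repeat split; try nra.
  destruct (IH p) as [Hp _]. destruct (IH (p - 1)%nat) as [Hp1 _].
  apply Rle_trans with (1 := Rabs_triang _ _). rewrite !Rabs_mult.
  rewrite (Rabs_right (INR p)) by apply Rle_ge, pos_INR. fold t.
  assert (H1x : Rabs (1 + c k * x) <= 1 + t * r).
  { apply Rle_trans with (1 := Rabs_triang _ _).
    rewrite Rabs_R1, Rabs_mult. apply Rplus_le_compat_l.
    apply Rmult_le_compat_l; auto. }
  apply Rle_trans with (A * s ^ p * (1 + t * r) + INR p * t * (A * s ^ (p - 1))).
  + apply Rplus_le_compat.
    * apply Rmult_le_compat; try apply Rabs_pos; auto.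
    * apply Rmult_le_compat_l; auto. apply Rmult_le_pos; [apply pos_INR | auto].
  + pose proof (pow_add_ge s t p HS0 Hc).
    pose proof (pow_le s (p - 1) HS0). pose proof (pos_INR p).
    apply Rle_trans with (A * (1 + t * r) * (s ^ p + INR p * t * s ^ (p - 1))).
    * assert (0 <= A * (t * r) * (INR p * t * s ^ (p - 1))).
      { repeat apply Rmult_le_pos; auto; lra. }
      lra.
    * apply Rmult_le_compat_l; [nra | auto].
Qed.

(** * Euler's limit at positive arguments *)

Lemma ln_1p_le (a : R) : 0 < 1 + a -> ln (1 + a) <= a.
Proof.
intro Ha. rewrite <- (ln_exp a) at 2. apply ln_le; [exact Ha | apply exp_ineq1_le].
Qed.

Lemma ln_1p_ge (a : R) : 0 < 1 + a -> a / (1 + a) <= ln (1 + a).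
Proof.
intro Ha.
assert (H : 1 + - (a / (1 + a)) = / (1 + a)) by (field; lra).
pose proof (ln_1p_le (- (a / (1 + a)))) as L. rewrite H in L.
rewrite ln_Rinv in L by exact Ha.
assert (0 < / (1 + a)) by now apply Rinv_0_lt_compat. lra.
Qed.

Definition euler_seq (y : R) (N : nat) : R :=
  INR (fact N) * Rpower (INR N) y / prod_f_R0 (fun j => y + INR j) N.

Lemma rising_pos (y : R) (N : nat) : 0 < y ->
  0 < prod_f_R0 (fun j => y + INR j) N.
Proof.
intro Hy. induction N as [|N IH]; cbn [prod_f_R0].
- simpl. lra.
- apply Rmult_lt_0_compat; [exact IH|]. pose proof (pos_INR (S N)). lra.
Qed.

Lemma euler_seq_pos (y : R) (N : nat) : 0 < y -> 0 < euler_seq y N.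
Proof.
intro Hy. unfold euler_seq. apply Rdiv_lt_0_compat; [|now apply rising_pos].
apply Rmult_lt_0_compat; [apply INR_fact_lt_0 | apply exp_pos].
Qed.

(** With [M = N + 1] the step is [y ln(1 + 1/M) - ln(1 + y/(M+1))]. The bounds
    [a/(1+a) <= ln(1+a) <= a] make it nonnegative and dominate it by a telescoping term. *)
Lemma euler_seq_log_step (y : R) (N : nat) : 0 < y ->
  0 <= ln (euler_seq y (S (S N))) - ln (euler_seq y (S N))
    <= y * (1 + y) * (/ INR (S N) - / INR (S (S N))).
Proof.
intro Hy.
assert (HM : 0 < INR (S N)) by (apply lt_0_INR; lia).
assert (E : ln (euler_seq y (S (S N))) - ln (euler_seq y (S N))
            = y * ln (1 + / INR (S N)) - ln (1 + y / INR (S (S N)))).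
{ assert (L : forall K, ln (euler_seq y (S K)) = ln (INR (fact (S K)))
      + y * ln (INR (S K)) - ln (prod_f_R0 (fun j => y + INR j) (S K))).
  { intro K. unfold euler_seq.
    rewrite ln_div, ln_mult; try apply exp_pos; try apply INR_fact_lt_0;
      try now apply rising_pos.
    - unfold Rpower. now rewrite ln_exp.
    - apply Rmult_lt_0_compat; [apply INR_fact_lt_0 | apply exp_pos]. }
  rewrite !L. cbn [prod_f_R0].
  rewrite (ln_mult _ (y + INR (S (S N))));
    [| apply (rising_pos y (S N) Hy) | pose proof (pos_INR (S (S N))); lra].
  replace (fact (S (S N))) with (S (S N) * fact (S N))%nat by reflexivity.
  rewrite mult_INR, ln_mult; [| apply lt_0_INR; lia | apply INR_fact_lt_0].
  replace (1 + / INR (S N)) with (INR (S (S N)) / INR (S N))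
    by (rewrite (S_INR (S N)); field; lra).
  replace (1 + y / INR (S (S N))) with ((y + INR (S (S N))) / INR (S (S N)))
    by (rewrite (S_INR (S N)); field; lra).
  rewrite !ln_div; try (apply lt_0_INR; lia);
    [| pose proof (pos_INR (S (S N))); lra].
  cbn [prod_f_R0]. ring. }
rewrite E. rewrite (S_INR (S N)). set (M := INR (S N)) in *.
assert (HiM : 0 < / M) by now apply Rinv_0_lt_compat.
assert (HyM : 0 < y / (M + 1)) by (apply Rdiv_lt_0_compat; lra).
assert (U1 : ln (1 + / M) <= / M) by (apply ln_1p_le; lra).
assert (L1 : / M / (1 + / M) <= ln (1 + / M)) by (apply ln_1p_ge; lra).
assert (U2 : ln (1 + y / (M + 1)) <= y / (M + 1)) by (apply ln_1p_le; lra).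
assert (L2 : y / (M + 1) / (1 + y / (M + 1)) <= ln (1 + y / (M + 1)))
  by (apply ln_1p_ge; lra).
replace (/ M / (1 + / M)) with (/ (M + 1)) in L1 by (field; lra).
replace (y / (M + 1) / (1 + y / (M + 1))) with (y / (M + 1 + y)) in L2
  by (field; lra).
split.
- apply (Rmult_le_compat_l y) in L1; [|lra]. unfold Rdiv in *. lra.
- apply (Rmult_le_compat_l y) in U1; [|lra].
  apply Rle_trans with (y * / M - y / (M + 1 + y)); [lra|].
  assert (H : y * / M - y / (M + 1 + y) = y * (1 + y) * (/ M * / (M + 1 + y)))
    by (field; lra).
  assert (H' : / M - / (M + 1) = / M * / (M + 1)) by (field; lra).
  rewrite H, H'. apply Rmult_le_compat_l; [nra|].
  apply Rmult_le_compat_l; [lra|]. apply Rinv_le_contravar; lra.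
Qed.

(** The logarithms of Euler's sequence increase and are bounded, so they have a finite limit [l].
    Hence the sequence itself converges, and to the positive number [exp l]. *)
Lemma is_lim_seq_Gamma (y : R) : 0 < y ->
  is_lim_seq (euler_seq y) (Gamma y) /\ 0 < Gamma y.
Proof.
intro Hy.
set (L := fun N => ln (euler_seq y (S N))).
destruct (ex_finite_lim_seq_incr L (L 0%nat + y * (1 + y))) as [l Hl].
- intro N. pose proof (euler_seq_log_step y N Hy). unfold L. lra.
- intro N.
  assert (H : L N <= L 0%nat + y * (1 + y) * (1 - / INR (S N))).
  { induction N as [|N IH]; [simpl; lra|].
    pose proof (euler_seq_log_step y N Hy). fold (L N) (L (S N)) in H. lra. }
  assert (0 < / INR (S N)) by (apply Rinv_0_lt_compat, lt_0_INR; lia). nra.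
- assert (H : is_lim_seq (euler_seq y) (exp l)).
  { apply is_lim_seq_incr_1.
    apply is_lim_seq_ext with (fun N => exp (L N)).
    - intro N. unfold L. apply exp_ln, euler_seq_pos, Hy.
    - apply is_lim_seq_continuous; [|exact Hl].
      apply derivable_continuous_pt, derivable_pt_exp. }
  assert (E : Gamma y = exp l).
  { change (real (Lim_seq (euler_seq y)) = exp l).
    now rewrite (is_lim_seq_unique _ _ H). }
  rewrite E. split; [exact H | apply exp_pos].
Qed.

Lemma is_lim_seq_shift_ratio (a b : R) : 0 <= b ->
  is_lim_seq (fun N => (INR N + a) / (INR N + 1 + b)) 1.
Proof.
intro Hb.
apply is_lim_seq_ext with (fun N => 1 + (a - 1 - b) * / (INR N + (1 + b))).
- intro N. pose proof (pos_INR N). field. lra.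
- replace (Finite 1) with (Finite (1 + (a - 1 - b) * 0)) by (f_equal; ring).
  apply is_lim_seq_plus'; [apply is_lim_seq_const|].
  apply is_lim_seq_mult'; [apply is_lim_seq_const|].
  replace (Finite 0) with (Rbar_inv p_infty) by reflexivity.
  apply is_lim_seq_inv; [|discriminate].
  apply is_lim_seq_plus with p_infty (1 + b);
    [apply is_lim_seq_INR | apply is_lim_seq_const | reflexivity].
Qed.

(** Euler's sequence at [y + 1] is [y N / (N + 1 + y)] times the one at [y]. *)
Lemma Gamma_succ (y : R) : 0 < y -> Gamma (y + 1) = y * Gamma y.
Proof.
intro Hy.
assert (P : forall N, prod_f_R0 (fun j => y + 1 + INR j) N
                      = prod_f_R0 (fun j => y + INR j) N * (y + INR N + 1) / y).
{ induction N as [|N IH]; cbn [prod_f_R0].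
  - simpl. field. lra.
  - rewrite IH, S_INR. field. lra. }
assert (H : is_lim_seq (euler_seq (y + 1)) (y * Gamma y)).
{ apply is_lim_seq_ext_loc with
    (fun N => y * euler_seq y N * ((INR N + 0) / (INR N + 1 + y))).
  - exists 1%nat. intros N HN. unfold euler_seq. rewrite P, Rpower_plus.
    assert (0 < INR N) by (apply lt_0_INR; lia).
    rewrite Rpower_1 by assumption.
    pose proof (rising_pos y N Hy). field. lra.
  - replace (Finite (y * Gamma y)) with (Finite (y * Gamma y * 1))
      by (f_equal; ring).
    apply is_lim_seq_mult'; [|apply is_lim_seq_shift_ratio; lra].
    apply is_lim_seq_mult'; [apply is_lim_seq_const|].
    now apply is_lim_seq_Gamma. }
destruct (is_lim_seq_Gamma (y + 1)) as [H' _]; [lra|].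
apply is_lim_seq_unique in H. apply is_lim_seq_unique in H'.
rewrite H in H'. now injection H'.
Qed.

(** * Summable majorants for the products of 1 - e/i *)

Definition hcoef (i : nat) : R := - / INR (S i).

(** The product of [1 + 1/(2i)] for [1 <= i <= k] grows like the square root of [k], hence remains
    summable after division by [k^2]. *)
Definition hmaj (k : nat) : R := dprod (fun i => / INR (S i)) k 0 (1 / 2).

Lemma hmaj_S (k : nat) : hmaj (S k) = hmaj k * (1 + / (2 * INR (S k))).
Proof.
unfold hmaj; cbn [dprod]. change (INR 0) with 0.
assert (INR (S k) <> 0) by (apply not_0_INR; lia). field; auto.
Qed.

Lemma hmaj_pos (k : nat) : 0 < hmaj k.
Proof.
induction k as [|k IH]; [unfold hmaj; simpl; lra|].
rewrite hmaj_S. apply Rmult_lt_0_compat; auto.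
assert (0 < / (2 * INR (S k))); [|lra].
apply Rinv_0_lt_compat. pose proof (lt_0_INR (S k)). assert (0 < S k)%nat by lia.
intuition lra.
Qed.

(* The majorant [2 * hmaj k / ((k+1)(k+2))] telescopes: it is four times the
   difference of [hmaj k / (k+1)] and [hmaj (k+1) / (k+2)]. *)
Lemma ex_series_hmaj : ex_series (fun k => hmaj k / INR (S k) ^ 2).
Proof.
apply ex_series_dominated with
  (fun k => 2 * (hmaj k / (INR (S k) * INR (S (S k))))).
{ intro k. pose proof (hmaj_pos k). assert (Hk : 0 < INR (S k)) by (apply lt_0_INR; lia).
  assert (1 <= INR (S k)) by (apply (le_INR 1); lia).
  rewrite (S_INR (S k)). set (t := INR (S k)) in *.
  rewrite Rabs_right by (apply Rle_ge, Rlt_le, Rdiv_lt_0_compat; nra).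
  replace (2 * (hmaj k / (t * (t + 1)))) with (hmaj k * (2 / (t * (t + 1))))
    by (field; lra).
  unfold Rdiv at 1. apply Rmult_le_compat_l; [lra|].
  apply (Rmult_le_reg_r (t ^ 2 * (t + 1))); [nra|].
  field_simplify; nra. }
apply (ex_series_scal 2 (fun k => hmaj k / (INR (S k) * INR (S (S k))))).
apply ex_series_bounded with 2.
{ intro k. pose proof (hmaj_pos k). apply Rlt_le, Rdiv_lt_0_compat; auto.
  apply Rmult_lt_0_compat; apply lt_0_INR; lia. }
assert (H : forall N, sum_n (fun k => hmaj k / (INR (S k) * INR (S (S k)))) N
                      = 2 - 2 * (hmaj (S N) / INR (S (S N)))).
{ induction N as [|N IH].
  - rewrite sum_O, hmaj_S. unfold hmaj. simpl. field.
  - rewrite sum_Sn, IH, (hmaj_S (S N)). 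
    change (2 - 2 * (hmaj (S N) / INR (S (S N)))
      + hmaj (S N) / (INR (S (S N)) * INR (S (S (S N))))
      = 2 - 2 * (hmaj (S N) * (1 + / (2 * INR (S (S N)))) / INR (S (S (S N))))).
    rewrite (S_INR (S (S N))), (S_INR (S N)).
    assert (0 < INR (S N)) by (apply lt_0_INR; lia).
    set (t := INR (S N)) in *. field. lra. }
intro N. rewrite H. pose proof (hmaj_pos (S N)).
assert (0 < hmaj (S N) / INR (S (S N))); [|lra].
apply Rdiv_lt_0_compat; auto. apply lt_0_INR; lia.
Qed.

Lemma hcoef_maj_pow4 (k : nat) :
  dprod (fun i => Rabs (hcoef i)) k 0 (1 / 30) ^ 4 <= hmaj k /\
  dprod (fun i => Rabs (hcoef i)) k 0 (1 / 30) ^ 4 <= INR (S k) /\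
  1 <= dprod (fun i => Rabs (hcoef i)) k 0 (1 / 30).
Proof.
induction k as [|k IH].
- unfold hmaj. simpl. lra.
- rewrite hmaj_S.
  assert (Hk : 1 <= INR (S k)) by (apply (le_INR 1); lia).
  assert (E : dprod (fun i => Rabs (hcoef i)) (S k) 0 (1 / 30)
    = dprod (fun i => Rabs (hcoef i)) k 0 (1 / 30) * (1 + / INR (S k) * (1 / 30))).
  { assert (Hc : Rabs (hcoef k) = / INR (S k))
      by (unfold hcoef; rewrite Rabs_Ropp, Rabs_inv, Rabs_right; lra).
    cbn [dprod]. rewrite Hc. change (INR 0) with 0. ring. }
  rewrite E.
  set (A := dprod (fun i => Rabs (hcoef i)) k 0 (1 / 30)) in *.
  rewrite (S_INR (S k)).
  replace (/ (2 * INR (S k))) with (/ INR (S k) / 2) by (field; lra).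
  assert (Hi : INR (S k) * / INR (S k) = 1) by (field; lra).
  assert (Hi0 : 0 < / INR (S k)) by (apply Rinv_0_lt_compat; lra).
  assert (Hi1 : / INR (S k) <= 1) by nra.
  set (s := / INR (S k)) in *. set (t := INR (S k)) in *.
  destruct IH as [IH1 [IH2 IH3]].
  (* For [v] in [0,1], [(1+v)^4 <= 1 + (4+6+4+1) v]; with [v = s/30] the right side is the factor
     [1 + s/2] of [hmaj]. *)
  assert (P : (1 + s * (1 / 30)) ^ 4 <= 1 + s / 2).
  { set (v := s * (1 / 30)). assert (s / 2 = 15 * v) by (unfold v; lra).
    assert (0 <= v <= 1) by (unfold v; lra). rewrite H.
    assert (v * v <= v) by nra. assert (v * v * v <= v) by nra.
    assert (v * v * v * v <= v) by nra. lra. }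
  rewrite Rpow_mult_distr.
  assert (0 <= A ^ 4) by (apply pow_le; lra).
  assert (0 <= (1 + s * (1 / 30)) ^ 4) by (apply pow_le; lra).
  repeat split.
  + apply Rmult_le_compat; auto.
  + apply Rle_trans with (t * (1 + s / 2)); [apply Rmult_le_compat; auto|]. nra.
  + nra.
Qed.

(* The radius 1/30 is chosen so that three derivatives, each costing one more
   factor of the product, stay below the summable [hmaj]. *)
Lemma dprod_hcoef_bound (k p : nat) (x : R) : Rabs x <= 1 / 30 -> (p <= 3)%nat ->
  Rabs (dprod hcoef k p x) <= 27000 * hmaj k.
Proof.
intros Hx Hp.
destruct (dprod_bound hcoef (1 / 30) x k p Hx) as [H [_ [HS [HS0 _]]]].
destruct (hcoef_maj_pow4 k) as [H4 [_ H1]].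
set (A := dprod (fun i => Rabs (hcoef i)) k 0 (1 / 30)) in *.
set (s := dprod (fun i => Rabs (hcoef i)) k 1 0) in *.
apply Rle_trans with (1 := H).
apply Rle_trans with (27000 * A ^ 4); [|lra].
assert (P1 : s ^ p <= (30 * A) ^ p) by (apply pow_incr; lra).
assert (P2 : (30 * A) ^ p <= (30 * A) ^ 3) by (apply Rle_pow; [lra|exact Hp]).
apply Rle_trans with (A * (30 * A) ^ 3).
- apply Rmult_le_compat_l; lra.
- simpl. lra.
Qed.

(** The majorant [A >= 1] satisfies [A^4 <= k + 1], so [A <= A^2 <= sqrt (k + 1)] and the quotient
    is at most [1 / sqrt (k + 1)]. *)
Lemma dprod_hcoef_vanish (x : R) : Rabs x <= 1 / 30 ->
  is_lim_seq (fun k => dprod hcoef k 0 x / INR (S k)) 0.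
Proof.
intro Hx.
apply is_lim_seq_abs_0.
apply is_lim_seq_le_le with (fun _ => 0) (fun k => / sqrt (INR (S k))).
- intro k. split; [apply Rabs_pos|].
  destruct (dprod_bound hcoef (1 / 30) x k 0 Hx) as [H _].
  destruct (hcoef_maj_pow4 k) as [_ [H4 H1]].
  set (A := dprod (fun i => Rabs (hcoef i)) k 0 (1 / 30)) in *.
  assert (Hk : 0 < INR (S k)) by (apply lt_0_INR; lia).
  unfold Rdiv. rewrite Rabs_mult, Rabs_inv, (Rabs_right (INR (S k))) by lra.
  assert (Hs := sqrt_lt_R0 _ Hk). assert (Hss := sqrt_sqrt (INR (S k))).
  set (q := sqrt (INR (S k))) in *.
  assert (HA : A <= q).
  { apply Rsqr_incr_0_var; [|lra]. unfold Rsqr. rewrite Hss by lra.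
    assert (1 <= A * A) by nra.
    assert (A * A <= (A * A) * (A * A)) by nra. 
    replace (A ^ 4) with ((A * A) * (A * A)) in H4 by ring. lra. }
  simpl in H. rewrite Rmult_1_r in H.
  apply (Rmult_le_reg_r (INR (S k))); [exact Hk|].
  rewrite Rmult_assoc, Rinv_l, Rmult_1_r by lra.
  rewrite <- Hss by lra. rewrite <- Rmult_assoc, Rinv_l by lra. lra.
- apply is_lim_seq_const.
- replace (Finite 0) with (Rbar_inv p_infty) by reflexivity.
  apply is_lim_seq_inv; [|discriminate].
  apply (filterlim_comp _ _ _ (fun k => INR (S k)) sqrt _ (Rbar_locally p_infty)).
  + apply (is_lim_seq_incr_1 INR p_infty), is_lim_seq_INR.
  + apply filterlim_sqrt_p.
Qed.

(** * The series for the Gamma quotient *)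

(* [sbin x k] is [(-1)^k] times the generalized binomial coefficient [x] over [k]. *)
Fixpoint sbin (x : R) (k : nat) : R :=
  match k with
  | O => 1
  | S k => sbin x k * ((INR k - x) / INR (S k))
  end.

Lemma sbin_S (x : R) (k : nat) :
  sbin x (S k) = sbin x k * ((INR k - x) / INR (S k)).
Proof. reflexivity. Qed.

Lemma INR_S_pos (k : nat) : 0 < INR (S k).
Proof. apply lt_0_INR; lia. Qed.

(** The absorption identity for binomial coefficients, in product form so that it also holds when
    [x + 1 = k]. *)
Lemma sbin_succ_arg (x : R) (k : nat) :
  (x + 1 - INR k) * sbin (x + 1) k = (x + 1) * sbin x k.
Proof.
induction k as [|k IH]; [simpl; ring|].
cbn [sbin]. pose proof (INR_S_pos k).
replace ((x + 1 - INR (S k))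
         * (sbin (x + 1) k * ((INR k - (x + 1)) / INR (S k))))
  with (- (x + 1 - INR (S k)) / INR (S k) * ((x + 1 - INR k) * sbin (x + 1) k))
  by (field; lra).
rewrite IH, S_INR in *. field. lra.
Qed.

Lemma sbin_pascal (x : R) (k : nat) :
  sbin (x + 1) (S k) = sbin x (S k) - sbin x k.
Proof.
cbn [sbin]. pose proof (INR_S_pos k).
replace (sbin (x + 1) k * ((INR k - (x + 1)) / INR (S k)))
  with (- / INR (S k) * ((x + 1 - INR k) * sbin (x + 1) k)) by (field; lra).
rewrite sbin_succ_arg, S_INR in *. field. lra.
Qed.

(** * Factorization of the coefficients at x = n + e *)

(* Only used for [i < n], where the subtraction is not truncated. *)
Definition pcoef (n i : nat) : R := / INR (n - i).

Lemma C_succ_r (n k : nat) : (k < n)%nat ->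
  Binomial.C n (S k) = Binomial.C n k * INR (n - k) / INR (S k).
Proof.
intro Hk. unfold Binomial.C.
replace (n - k)%nat with (S (n - S k)) by lia.
rewrite !fact_simpl, !mult_INR. pose proof (INR_S_pos k).
pose proof (INR_S_pos (n - S k)).
pose proof (INR_fact_lt_0 k). pose proof (INR_fact_lt_0 (n - S k)).
field. lra.
Qed.

Lemma C_diag_succ (n j : nat) :
  Binomial.C (n + S j) (S j) = Binomial.C (n + j) j * INR (n + j + 1) / INR (S j).
Proof.
unfold Binomial.C.
replace (n + S j - S j)%nat with n by lia.
replace (n + j - j)%nat with n by lia.
replace (n + S j)%nat with (S (n + j)) by lia.
replace (n + j + 1)%nat with (S (n + j)) by lia.
rewrite !fact_simpl, !mult_INR. pose proof (INR_S_pos j).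
pose proof (INR_fact_lt_0 j). pose proof (INR_fact_lt_0 n).
field. lra.
Qed.

Lemma C_diag_ge1 (n j : nat) : 1 <= Binomial.C (n + j) j.
Proof.
induction j as [|j IH].
- unfold Binomial.C. rewrite Nat.add_0_r, Nat.sub_0_r. simpl.
  pose proof (INR_fact_lt_0 n). right. field. lra.
- rewrite C_diag_succ. pose proof (INR_S_pos j).
  assert (INR (S j) <= INR (n + j + 1)) by (apply le_INR; lia).
  apply (Rmult_le_reg_r (INR (S j))); auto. unfold Rdiv.
  rewrite Rmult_assoc, Rinv_l, Rmult_1_r by lra. nra.
Qed.

Lemma sbin_head (n k : nat) (e : R) : (k <= n)%nat ->
  sbin (INR n + e) k = (-1) ^ k * Binomial.C n k * dprod (pcoef n) k 0 e.
Proof.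
induction k as [|k IH]; intro Hk.
- unfold Binomial.C. rewrite Nat.sub_0_r. simpl.
  pose proof (INR_fact_lt_0 n). field. lra.
- cbn [sbin dprod]. rewrite IH by lia. rewrite C_succ_r by lia.
  change (pcoef n k) with (/ INR (n - k)). pose proof (INR_S_pos k).
  assert (0 < INR (n - k)) by (apply lt_0_INR; lia).
  rewrite minus_INR in * by lia. simpl (_ ^ S k). change (INR 0) with 0.
  field. lra.
Qed.

(** The step from index [n] to [n + 1] contributes [n - x = -e], the source of the factor [e]; each
    later step contributes [i - e], that is [i] times a factor of the [hcoef] product. *)
Lemma sbin_tail (n j : nat) (e : R) :
  sbin (INR n + e) (S (n + j)) =
    - (-1) ^ n * e * dprod (pcoef n) n 0 e * dprod hcoef j 0 e
    / (Binomial.C (n + j) j * INR (n + j + 1)).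
Proof.
induction j as [|j IH].
- rewrite Nat.add_0_r. cbn [sbin]. rewrite sbin_head by lia.
  replace (n + 1)%nat with (S n) by lia. pose proof (INR_S_pos n).
  unfold Binomial.C. rewrite Nat.sub_diag, Nat.sub_0_r. simpl (fact 0).
  simpl (dprod _ 0 _ _). change (INR 1) with 1.
  pose proof (INR_fact_lt_0 n). field. lra.
- replace (n + S j)%nat with (S (n + j)) at 1 by lia.
  rewrite sbin_S, IH. cbn [dprod]. rewrite C_diag_succ.
  pose proof (C_diag_ge1 n j). change (hcoef j) with (- / INR (S j)).
  replace (INR (S (S (n + j)))) with (INR (n + S j + 1)) by (f_equal; lia).
  replace (INR (S (n + j))) with (INR n + INR (S j))
    by (rewrite <- plus_INR; f_equal; lia).
  pose proof (INR_S_pos j). assert (0 < INR (n + j + 1)) by (apply lt_0_INR; lia).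
  assert (0 < INR (n + S j + 1)) by (apply lt_0_INR; lia).
  change (INR 0) with 0. set (t := INR (S j)) in *. field. lra.
Qed.

(** The first condition gives convergence of the series with ratios [w / (w + k)], the second
    removes the boundary terms of the telescoping sums below. *)
Definition bin_summable (x : R) : Prop :=
  ex_series (fun k => Rabs (sbin x (S k)) / INR (S k)) /\ is_lim_seq (sbin x) 0.

Lemma inv_C_diag_le (n j : nat) :
  0 < / (Binomial.C (n + j) j * INR (n + j + 1)) <= / INR (S j).
Proof.
pose proof (C_diag_ge1 n j). pose proof (INR_S_pos j).
assert (INR (S j) <= INR (n + j + 1)) by (apply le_INR; lia).
split.
- apply Rinv_0_lt_compat. nra.
- apply Rinv_le_contravar; nra.
Qed.

(** Both conditions concern only large indices, where [sbin_tail] gives a constant times a product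
    controlled by [hmaj], with a weight at most [1/(j+1)]; the summand supplies the second
    [1/(j+1)]. *)
Lemma bin_summable_near_nat (n : nat) (e : R) : Rabs e <= 1 / 30 ->
  bin_summable (INR n + e).
Proof.
intro He.
set (K := - (-1) ^ n * e * dprod (pcoef n) n 0 e).
assert (T : forall j, sbin (INR n + e) (S (n + j)) = K * dprod hcoef j 0 e
              * / (Binomial.C (n + j) j * INR (n + j + 1))).
{ intro j. rewrite sbin_tail. unfold K, Rdiv. ring. }
split.
- apply (ex_series_incr_n _ n).
  apply ex_series_dominated with
    (fun j => Rabs K * 27000 * (hmaj j / INR (S j) ^ 2)).
  2: exact (ex_series_scal (Rabs K * 27000) _ ex_series_hmaj).
  intro j. rewrite T.
  destruct (inv_C_diag_le n j) as [W0 W1].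
  pose proof (dprod_hcoef_bound j 0 e He ltac:(lia)) as B.
  pose proof (hmaj_pos j). pose proof (INR_S_pos j). pose proof (INR_S_pos (n + j)).
  assert (V : / INR (S (n + j)) <= / INR (S j)).
  { apply Rinv_le_contravar; auto. apply le_INR; lia. }
  assert (0 < / INR (S (n + j))) by now apply Rinv_0_lt_compat.
  unfold Rdiv.
  rewrite Rabs_mult, Rabs_Rabsolu, !Rabs_mult, (Rabs_right (/ (_ * _))) by lra.
  rewrite (Rabs_right (/ INR _)) by lra.
  replace (Rabs K * 27000 * (hmaj j * / INR (S j) ^ 2))
    with (Rabs K * (27000 * hmaj j) * / INR (S j) * / INR (S j)) by (field; lra).
  pose proof (Rabs_pos K). pose proof (Rabs_pos (dprod hcoef j 0 e)).
  repeat apply Rmult_le_compat; repeat apply Rmult_le_pos; try lra; auto.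
- apply (is_lim_seq_incr_n _ (S n)).
  apply is_lim_seq_abs_0.
  apply is_lim_seq_le_le with (fun _ => 0)
    (fun j => Rabs K * Rabs (dprod hcoef j 0 e / INR (S j))).
  + intro j. split; [apply Rabs_pos|].
    replace (j + S n)%nat with (S (n + j)) by lia. rewrite T.
    destruct (inv_C_diag_le n j) as [W0 W1]. pose proof (INR_S_pos j).
    assert (0 < / INR (S j)) by now apply Rinv_0_lt_compat.
    unfold Rdiv. rewrite !Rabs_mult, (Rabs_right (/ (_ * _))) by lra.
    rewrite (Rabs_right (/ INR _)) by lra. rewrite Rmult_assoc.
    apply Rmult_le_compat_l; [apply Rabs_pos|].
    apply Rmult_le_compat_l; [apply Rabs_pos | exact W1].
  + apply is_lim_seq_const.
  + replace (Finite 0) with (Finite (Rabs K * 0)) by (f_equal; ring).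
    apply is_lim_seq_mult'; [apply is_lim_seq_const|].
    now apply (proj1 (is_lim_seq_abs_0 (fun j => dprod hcoef j 0 e / INR (S j)))),
      dprod_hcoef_vanish.
Qed.

(** * The binomial series and its recurrences *)

Definition bterm (x w : R) (k : nat) : R :=
  sbin x (S k) * (w / (w + INR (S k))).

Definition bser (x w : R) : R := 1 + Series (bterm x w).

(** For [t >= 1], [w + t] is at least [min(1, 1+w) * t]. *)
Lemma ratio_bound (w : R) (k : nat) : -1 < w ->
  0 < w + INR (S k) /\
  Rabs (w / (w + INR (S k))) <= Rabs w / Rmin 1 (1 + w) * / INR (S k).
Proof.
intro Hw. assert (1 <= INR (S k)) by (apply (le_INR 1); lia).
assert (Hd : 0 < Rmin 1 (1 + w)) by (apply Rmin_pos; lra).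
assert (Hp : Rmin 1 (1 + w) * INR (S k) <= w + INR (S k)).
{ unfold Rmin. destruct (Rle_dec 1 (1 + w)); nra. }
assert (0 < w + INR (S k)) by nra. split; [assumption|].
unfold Rdiv. rewrite Rabs_mult, Rabs_inv, (Rabs_right (w + _)) by lra.
rewrite Rmult_assoc. apply Rmult_le_compat_l; [apply Rabs_pos|].
rewrite <- Rinv_mult. apply Rinv_le_contravar; nra.
Qed.

Lemma ex_series_bterm (x w : R) : bin_summable x -> -1 < w ->
  ex_series (bterm x w).
Proof.
intros [Hx _] Hw.
apply ex_series_dominated with
  (fun k => Rabs w / Rmin 1 (1 + w) * (Rabs (sbin x (S k)) / INR (S k))).
2: exact (ex_series_scal (Rabs w / Rmin 1 (1 + w)) _ Hx).
intro k. unfold bterm. rewrite Rabs_mult.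
destruct (ratio_bound w k Hw) as [_ H].
apply (Rmult_le_compat_l (Rabs (sbin x (S k)))) in H; [|apply Rabs_pos].
unfold Rdiv in *. lra.
Qed.

Lemma is_series_telescope (V : nat -> R) (l : R) : is_lim_seq V l ->
  is_series (fun k => V k - V (S k)) (V 0%nat - l).
Proof.
intro HV. change (is_lim_seq (sum_n (fun k => V k - V (S k))) (V 0%nat - l)).
apply is_lim_seq_ext with (fun N => V 0%nat - V (S N)).
- intro N. induction N as [|N IH]; [now rewrite sum_O|].
  rewrite sum_Sn, <- IH. unfold plus; simpl. ring.
- apply is_lim_seq_minus'; [apply is_lim_seq_const|].
  now apply (is_lim_seq_incr_1 V).
Qed.

(** Fixing the carrier to [R] leaves a termwise goal that [field] recognizes. *)
Lemma is_series_ext_R (a b : nat -> R) (l : R) :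
  (forall k, a k = b k) -> is_series a l -> is_series b l.
Proof. exact (is_series_ext a b l). Qed.

(** Termwise, the difference of the two sides is [(w+1)] times a difference of consecutive values of
    [V]. As [V] starts at [-x/(w+1)] and tends to 0, the sum is [-x], which offsets the constant
    terms. *)
Lemma bser_succ_w (x w : R) : bin_summable x -> -1 < w ->
  (w + 1 + x) * bser x (w + 1) = (w + 1) * bser x w.
Proof.
intros Hx Hw.
set (V := fun k => INR (S k) * sbin x (S k) / (w + INR (S k))).
assert (HV : is_lim_seq V 0).
{ apply is_lim_seq_incr_1.
  apply is_lim_seq_ext with
    (fun N => sbin x (S (S N)) * ((INR N + 2) / (INR N + 1 + (w + 1)))).
  - intro N. unfold V. rewrite (S_INR (S N)), (S_INR N). pose proof (pos_INR N).
    field. lra.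
  - replace (Finite 0) with (Finite (0 * 1)) by (f_equal; ring).
    apply is_lim_seq_mult'; [|apply is_lim_seq_shift_ratio; lra].
    destruct Hx as [_ Hx].
    now apply (is_lim_seq_incr_n _ 2) in Hx;
      apply is_lim_seq_ext with (2 := Hx); intro N; rewrite Nat.add_comm. }
assert (E : Series (fun k => (w + 1 + x) * bterm x (w + 1) k
                             - (w + 1) * bterm x w k) = - x).
{ apply is_series_unique.
  apply is_series_ext_R with (fun k => (w + 1) * (V k - V (S k))).
  - intro k. unfold V, bterm. cbn [sbin].
    rewrite (S_INR (S k)). destruct (ratio_bound w k Hw) as [H _].
    pose proof (INR_S_pos k). rewrite S_INR in *. pose proof (pos_INR k).
     field. lra.
  - replace (- x) with ((w + 1) * (V 0%nat - 0)).
    + exact (is_series_scal (w + 1) _ _ (is_series_telescope V 0 HV)).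
    + unfold V. simpl. field. lra. }
assert (H1 := ex_series_bterm x w Hx Hw).
assert (H2 : ex_series (bterm x (w + 1))) by (apply ex_series_bterm; [auto | lra]).
rewrite Series_minus, !Series_scal_l in E.
- unfold bser. lra.
- exact (ex_series_scal (w + 1 + x) _ H2).
- exact (ex_series_scal (w + 1) _ H1).
Qed.

(** Absorption puts both sides over the common coefficient [sbin (x + 1) (S k)], and Pascal's rule
    turns the result into a telescoping difference with sum [-w]. *)
Lemma bser_succ_x (x w : R) :
  bin_summable x -> bin_summable (x + 1) -> -1 < w ->
  (w + 1 + x) * bser (x + 1) w = (x + 1) * bser x w.
Proof.
intros Hx Hx1 Hw.
assert (H1 := ex_series_bterm x w Hx Hw).
assert (H2 := ex_series_bterm (x + 1) w Hx1 Hw).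
assert (E : Series (fun k => (w + 1 + x) * bterm (x + 1) w k
                             - (x + 1) * bterm x w k) = - w).
{ apply is_series_unique.
  apply is_series_ext_R with (fun k => - w * (sbin x k - sbin x (S k))).
  - intro k. unfold bterm.
    replace ((x + 1) * (sbin x (S k) * (w / (w + INR (S k)))))
      with ((x + 1) * sbin x (S k) * (w / (w + INR (S k)))) by apply Rmult_assoc.
    rewrite <- sbin_succ_arg.
    replace (sbin x k - sbin x (S k)) with (- sbin (x + 1) (S k))
      by (rewrite sbin_pascal; ring).
    destruct (ratio_bound w k Hw) as [H _]. set (b := sbin (x + 1) (S k)).
    set (t := INR (S k)) in *.  field. lra.
  - assert (Q : - w * (sbin x 0 - 0) = - w) by (simpl; ring).
    refine (eq_ind _ (is_series _) _ _ Q).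
    exact (is_series_scal (- w) _ _ (is_series_telescope _ _ (proj2 Hx))). }
rewrite Series_minus, !Series_scal_l in E.
- unfold bser. lra.
- exact (ex_series_scal (w + 1 + x) _ H2).
- exact (ex_series_scal (x + 1) _ H1).
Qed.

Lemma bser_0 (x : R) : bser x 0 = 1.
Proof.
unfold bser. rewrite (Series_ext _ (fun k => 0 * 0)).
- rewrite Series_scal_l. ring.
- intro k. unfold bterm, Rdiv. ring.
Qed.

Lemma bser_iter (x w : R) (N : nat) : bin_summable x -> -1 < w ->
  bser x (w + INR N + 1) * prod_f_R0 (fun j => w + x + 1 + INR j) N
  = bser x w * prod_f_R0 (fun j => w + 1 + INR j) N.
Proof.
intros Hx Hw. induction N as [|N IH]; cbn [prod_f_R0].
- change (INR 0) with 0. replace (w + 0 + 1) with (w + 1) by ring.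
  pose proof (bser_succ_w x w Hx Hw). lra.
- rewrite <- (Rmult_assoc (bser x w)), <- IH, S_INR. pose proof (pos_INR N).
  pose proof (bser_succ_w x (w + INR N + 1) Hx ltac:(lra)) as H'.
  replace (w + (INR N + 1) + 1) with (w + INR N + 1 + 1) by ring.
  set (P := prod_f_R0 _ N).
  transitivity (P * ((w + INR N + 1 + 1 + x) * bser x (w + INR N + 1 + 1)));
    [ring | rewrite H'; ring].
Qed.

Lemma dprod_hcoef_pos (k : nat) (x : R) : Rabs x <= 1 / 30 ->
  0 < dprod hcoef k 0 x.
Proof.
intro Hx. induction k as [|k IH]; cbn [dprod]; [lra|].
change (INR 0) with 0. rewrite !Rmult_0_l, Rplus_0_r.
apply Rmult_lt_0_compat; [exact IH|].
assert (1 <= INR (S k)) by (apply (le_INR 1); lia).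
assert (Hi : 0 < / INR (S k)) by (apply Rinv_0_lt_compat; lra).
assert (INR (S k) * / INR (S k) = 1) by (field; lra).
unfold hcoef. apply Rabs_le_between in Hx. nra.
Qed.

(** The case [n = 0] of [sbin_tail]: the factors [1 - x/i] are positive, so all coefficients after
    the first share the sign of [-x]. *)
Lemma sbin_sign (x : R) : Rabs x <= 1 / 30 ->
  exists c : nat -> R,
    (forall k, 0 <= c k) /\ (forall k, sbin x (S k) = - x * c k).
Proof.
intro Hx.
exists (fun j => dprod hcoef j 0 x * / (Binomial.C (0 + j) j * INR (0 + j + 1))).
split; intro j.
- destruct (inv_C_diag_le 0 j). pose proof (dprod_hcoef_pos j x Hx).
  apply Rmult_le_pos; lra.
- pose proof (sbin_tail 0 j x) as H. rewrite Rplus_0_l in H.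
  change (0 + j)%nat with j in *. rewrite H. simpl. unfold Rdiv. ring.
Qed.

(** Each [w / (w + k)] increases with [w] and the coefficients have a common sign, so [bser x] is
    monotone; absolute values cover both directions at once. *)
Lemma bser_between (x a b c : R) : Rabs x <= 1 / 30 -> -1 < a -> a <= b -> b <= c ->
  Rabs (bser x b - bser x a) <= Rabs (bser x c - bser x a).
Proof.
intros Hx Ha Hab Hbc.
assert (Hs : bin_summable x).
{ replace x with (INR 0 + x) by (simpl; ring). now apply bin_summable_near_nat. }
destruct (sbin_sign x Hx) as [q [Hq Hb]].
(* The case [x = 0] is separate because the summability of the terms with [q] comes from dividing
   those of [bterm] by [-x]. *)
destruct (Req_dec x 0) as [H0 | H0].
{ assert (E : forall w, bser x w = 1).
  { intro w. unfold bser. rewrite (Series_ext _ (fun k => 0 * 0)).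
    - rewrite Series_scal_l. ring.
    - intro k. unfold bterm. rewrite Hb, H0. ring. }
  rewrite !E. lra. }
set (T := fun w => Series (fun k => q k * (w / (w + INR (S k))))).
assert (ET : forall w, bser x w = 1 - x * T w).
{ intro w. unfold bser, T.
  rewrite (Series_ext (bterm x w) (fun k => - x * (q k * (w / (w + INR (S k)))))).
  - rewrite Series_scal_l. ring.
  - intro k. unfold bterm. rewrite Hb. ring. }
assert (HT : forall w, -1 < w -> ex_series (fun k => q k * (w / (w + INR (S k))))).
{ intros w Hw.
  apply ex_series_ext with (fun k => - / x * bterm x w k).
  - intro k. unfold bterm. rewrite Hb.
    destruct (ratio_bound w k Hw) as [P _]. set (t := INR (S k)) in *.
    change (- / x * (- x * q k * (w / (w + t))) = q k * (w / (w + t))).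
    field. split; lra.
  - exact (ex_series_scal (- / x) _ (ex_series_bterm x w Hs Hw)). }
assert (Tmono : forall w w', -1 < w -> w <= w' -> T w <= T w').
{ intros w w' Hw Hww. apply Rminus_le_0. unfold T.
  rewrite <- Series_minus by (apply HT; lra).
  apply Series_ge0.
  - intro k. rewrite <- Rmult_minus_distr_l. apply Rmult_le_pos; [apply Hq|].
    destruct (ratio_bound w k Hw) as [P _].
    destruct (ratio_bound w' k) as [P' _]; [lra|]. pose proof (INR_S_pos k).
    replace (w' / (w' + INR (S k)) - w / (w + INR (S k)))
      with ((w' - w) * INR (S k) / ((w' + INR (S k)) * (w + INR (S k))))
      by (field; lra).
    apply Rmult_le_pos; [nra|]. apply Rlt_le, Rinv_0_lt_compat. nra.
  - apply (ex_series_minus (fun k => q k * (w' / (w' + INR (S k))))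
             (fun k => q k * (w / (w + INR (S k))))); apply HT; lra. }
rewrite !ET.
replace (1 - x * T b - (1 - x * T a)) with (- x * (T b - T a)) by ring.
replace (1 - x * T c - (1 - x * T a)) with (- x * (T c - T a)) by ring.
rewrite !Rabs_mult. apply Rmult_le_compat_l; [apply Rabs_pos|].
pose proof (Tmono a b Ha Hab). pose proof (Tmono b c ltac:(lra) Hbc).
rewrite !Rabs_right; lra.
Qed.

(** The iterated recurrence in terms of Euler's sequences: the factorials cancel and the powers of
    [N] leave [N^x]. *)
Lemma bser_euler_seq (x w : R) (N : nat) : bin_summable x -> -1 < w ->
  0 < w + x + 1 -> (1 <= N)%nat ->
  Rpower (INR N) x * bser x (w + INR N + 1)
  = bser x w * (euler_seq (w + x + 1) N / euler_seq (w + 1) N).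
Proof.
intros Hx Hw Hwx HN.
pose proof (bser_iter x w N Hx Hw) as H.
unfold euler_seq.
replace (w + x + 1) with (w + 1 + x) at 1 by ring. rewrite Rpower_plus.
pose proof (rising_pos (w + x + 1) N Hwx).
pose proof (rising_pos (w + 1) N ltac:(lra)).
set (P := prod_f_R0 (fun j => w + x + 1 + INR j) N) in *.
set (Q := prod_f_R0 (fun j => w + 1 + INR j) N) in *.
assert (E : bser x (w + INR N + 1) = bser x w * Q / P)
  by (rewrite <- H; field; lra).
rewrite E. pose proof (INR_fact_lt_0 N).
assert (0 < Rpower (INR N) (w + 1)) by apply exp_pos. field. lra.
Qed.

Lemma is_lim_seq_Gamma_ratio (a b : R) : 0 < a -> 0 < b ->
  is_lim_seq (fun N => euler_seq a N / euler_seq b N) (Gamma a / Gamma b).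
Proof.
intros Ha Hb.
destruct (is_lim_seq_Gamma a Ha) as [La _].
destruct (is_lim_seq_Gamma b Hb) as [Lb Pb].
apply is_lim_seq_div'; auto. lra.
Qed.

Lemma Gamma_1 : Gamma 1 = 1.
Proof.
replace 1 with (INR 0 + 1) at 1 by (simpl; ring). now rewrite Gamma_fact.
Qed.

(* [bser x] is monotone, so its growth at real arguments is squeezed between
   that at the neighbouring integers, where the recurrence gives it exactly. *)
Lemma bser_growth (x w : R) : Rabs x <= 1 / 30 -> -1 < w < 1 ->
  is_lim_seq (fun N => Rpower (INR N) x * bser x (w + INR N + 1)) (Gamma (x + 1)).
Proof.
intros Hx Hw. assert (Hx' := Hx). apply Rabs_le_between in Hx'.
assert (Hs : bin_summable x).
{ replace x with (INR 0 + x) by (simpl; ring). now apply bin_summable_near_nat. }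
set (a := fun v N => Rpower (INR N) x * bser x (v + INR N + 1)).
(* At [w = 0] the series equals 1 and the growth is explicit. Shifts -1 and 1 follow by one step of
   the recurrence at [N] or [N + 1], so the series is never evaluated at -1, where its first term
   has a pole. *)
assert (A0 : is_lim_seq (a 0) (Gamma (x + 1))).
{ apply is_lim_seq_ext_loc with
    (fun N => euler_seq (0 + x + 1) N / euler_seq (0 + 1) N).
  - exists 1%nat. intros N HN. unfold a.
    rewrite bser_euler_seq by (auto; lra). rewrite bser_0. ring.
  - replace (Gamma (x + 1)) with (Gamma (0 + x + 1) / Gamma (0 + 1)).
    + apply is_lim_seq_Gamma_ratio; lra.
    + rewrite !Rplus_0_l, Gamma_1. field. }
assert (Am : is_lim_seq (a (-1)) (Gamma (x + 1))).
{ apply is_lim_seq_ext with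
    (fun N => a 0 N * ((INR N + (1 + x)) / (INR N + 1 + 0))).
  - intro N. unfold a. pose proof (pos_INR N).
    pose proof (bser_succ_w x (INR N) Hs ltac:(lra)) as E.
    replace (-1 + INR N + 1) with (INR N) by ring.
    replace (0 + INR N + 1) with (INR N + 1) by ring.
    assert (E' : bser x (INR N)
                 = (INR N + 1 + x) * bser x (INR N + 1) / (INR N + 1))
      by (rewrite E; field; lra).
    rewrite E'. field. lra.
  - replace (Finite (Gamma (x + 1))) with (Finite (Gamma (x + 1) * 1))
      by (f_equal; ring).
    apply is_lim_seq_mult'; [exact A0 | apply is_lim_seq_shift_ratio; lra]. }
assert (Ap : is_lim_seq (a 1) (Gamma (x + 1))).
{ apply is_lim_seq_ext with
    (fun N => a 0 N * ((INR N + 2) / (INR N + 1 + (1 + x)))).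
  - intro N. unfold a. pose proof (pos_INR N).
    pose proof (bser_succ_w x (INR N + 1) Hs ltac:(lra)) as E.
    replace (1 + INR N + 1) with (INR N + 1 + 1) by ring.
    replace (0 + INR N + 1) with (INR N + 1) by ring.
    assert (E' : bser x (INR N + 1 + 1)
                 = (INR N + 1 + 1) * bser x (INR N + 1) / (INR N + 1 + 1 + x))
      by (rewrite <- E; field; lra).
    rewrite E'. field. lra.
  - replace (Finite (Gamma (x + 1))) with (Finite (Gamma (x + 1) * 1))
      by (f_equal; ring).
    apply is_lim_seq_mult'; [exact A0 | apply is_lim_seq_shift_ratio; lra]. }
assert (D : is_lim_seq (fun N => a w N - a (-1) N) 0).
{ apply is_lim_seq_abs_0.
  apply is_lim_seq_le_le with (fun _ => 0) (fun N => Rabs (a 1 N - a (-1) N)).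
  - intro N. split; [apply Rabs_pos|]. unfold a. pose proof (pos_INR N).
    rewrite <- !Rmult_minus_distr_l, !Rabs_mult.
    apply Rmult_le_compat_l; [apply Rabs_pos|].
    apply bser_between; auto; lra.
  - apply is_lim_seq_const.
  - apply (proj1 (is_lim_seq_abs_0 (fun N => a 1 N - a (-1) N))).
    replace (Finite 0) with (Finite (Gamma (x + 1) - Gamma (x + 1)))
      by (f_equal; ring).
    now apply is_lim_seq_minus'. }
apply is_lim_seq_ext with (fun N => (a w N - a (-1) N) + a (-1) N).
- intro N. unfold a. ring.
- replace (Finite (Gamma (x + 1))) with (Finite (0 + Gamma (x + 1)))
    by (f_equal; ring).
  now apply is_lim_seq_plus'.
Qed.

(** For [n = 0] the constant [bser e w] is the limit of its growth factor times a ratio of Euler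
    sequences. The growth is known only near [x = 0], where the signs are controlled; induction by
    the recurrence in [x] reaches the other [n]. *)
Lemma bser_Gamma (n : nat) (e w : R) : Rabs e <= 1 / 30 -> Rabs w < 1 / 2 ->
  bser (INR n + e) w
  = Gamma (INR n + e + 1) * Gamma (w + 1) / Gamma (w + (INR n + e) + 1).
Proof.
intros He Hw. assert (He' := He). apply Rabs_le_between in He'.
assert (Hw' := Hw). apply Rabs_lt_between in Hw'.
induction n as [|n IH].
- change (INR 0) with 0. rewrite !Rplus_0_l.
  assert (Hs : bin_summable e).
  { replace e with (INR 0 + e) by (simpl; ring). now apply bin_summable_near_nat. }
  assert (L : is_lim_seq (fun _ => bser e w)
                (Gamma (e + 1) * (Gamma (w + 1) / Gamma (w + e + 1)))).
  { apply is_lim_seq_ext_loc with (fun N =>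
      Rpower (INR N) e * bser e (w + INR N + 1)
      * (euler_seq (w + 1) N / euler_seq (w + e + 1) N)).
    - exists 1%nat. intros N HN. rewrite bser_euler_seq by (auto; lra).
      pose proof (euler_seq_pos (w + 1) N ltac:(lra)).
      pose proof (euler_seq_pos (w + e + 1) N ltac:(lra)). field. lra.
    - apply is_lim_seq_mult'.
      + apply bser_growth; [auto | lra].
      + apply is_lim_seq_Gamma_ratio; lra. }
  apply is_lim_seq_unique in L. rewrite Lim_seq_const in L.
  injection L as L. rewrite L. unfold Rdiv. ring.
- pose proof (pos_INR n).
  assert (Hs := bin_summable_near_nat n e He).
  assert (Hs1 : bin_summable (INR n + e + 1)).
  { replace (INR n + e + 1) with (INR (S n) + e) by (rewrite S_INR; ring).
    now apply bin_summable_near_nat. }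
  pose proof (bser_succ_x (INR n + e) w Hs Hs1 ltac:(lra)) as E.
  replace (INR (S n) + e) with (INR n + e + 1) by (rewrite S_INR; ring).
  rewrite (Gamma_succ (INR n + e + 1)) by lra.
  replace (w + (INR n + e + 1) + 1) with (w + (INR n + e) + 1 + 1) by ring.
  rewrite (Gamma_succ (w + (INR n + e) + 1)) by lra.
  destruct (is_lim_seq_Gamma (w + (INR n + e) + 1) ltac:(lra)) as [_ Hg].
  rewrite IH in E.
  apply (Rmult_eq_reg_l (w + 1 + (INR n + e))); [|lra].
  rewrite E. field. split; lra.
Qed.

(** * Derivatives in z *)

(* The [p]-th derivative in [w] of [bterm x w k]; for [p > 0] it is that of
   [- sbin x (k+1) * (k+1) / (w + (k+1))]. *)
Definition dbterm (x : R) (p k : nat) (w : R) : R :=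
  match p with
  | O => bterm x w k
  | S _ => - (-1) ^ p * INR (fact p) * sbin x (S k) * INR (S k)
           / (w + INR (S k)) ^ S p
  end.

Lemma is_derive_dbterm (x : R) (p k : nat) (w : R) : -1 < w ->
  is_derive (dbterm x p k) w (dbterm x (S p) k w).
Proof.
intro Hw. destruct (ratio_bound w k Hw) as [Hp _].
destruct p as [|p].
- apply (is_derive_ext (fun w => sbin x (S k) * (w / (w + INR (S k)))));
    [reflexivity|].
  unfold dbterm. set (b := sbin x (S k)). set (t := INR (S k)) in *.
  auto_derive; [lra|]. simpl. field. lra.
- apply (is_derive_ext (fun w => - (-1) ^ S p * INR (fact (S p)) * sbin x (S k)
           * INR (S k) * / (w + INR (S k)) ^ S (S p))); [reflexivity|].
  unfold dbterm. rewrite (fact_simpl (S p)), mult_INR.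
  set (b := sbin x (S k)). set (t := INR (S k)) in *.
  set (f := INR (fact (S p))).
  assert (Hq : (w + t) ^ p <> 0) by (apply pow_nonzero; lra).
  auto_derive.
  + apply Rmult_integral_contrapositive_currified; [lra|].
    apply Rmult_integral_contrapositive_currified; [lra | exact Hq].
  + change (match p with O => 1 | S _ => INR p + 1 end) with (INR (S p)).
    rewrite (S_INR (S p)). simpl (_ ^ S _). field. split; [exact Hq | lra].
Qed.

Lemma ex_series_dbterm_bound (x : R) (p : nat) : bin_summable x ->
  exists M, ex_series M /\
    forall k w, Rabs w < 1 / 2 -> Rabs (dbterm x (S p) k w) <= M k.
Proof.
intros [Hx _].
exists (fun k => INR (fact (S p)) * 2 ^ S (S p) * (Rabs (sbin x (S k)) / INR (S k))).
split; [exact (ex_series_scal (INR (fact (S p)) * 2 ^ S (S p)) _ Hx)|].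
intros k w Hw. apply Rabs_lt_between in Hw.
assert (Hk : 1 <= INR (S k)) by (apply (le_INR 1); lia).
unfold dbterm. set (b := sbin x (S k)). set (t := INR (S k)) in *.
unfold Rdiv. rewrite !Rabs_mult, Rabs_Ropp, pow_1_abs, Rabs_inv.
pose proof (INR_fact_lt_0 (S p)) as Hf.
rewrite (Rabs_right (INR (fact (S p)))), (Rabs_right t) by lra.
assert (Hwt : t / 2 <= w + t) by lra.
rewrite (Rabs_right ((w + t) ^ S (S p))) by (apply Rle_ge, pow_le; lra).
(* Of the [p + 2] powers of [t], two suffice: one cancels the numerator [t] and the other gives the
   summable [1/t]. *)
assert (Hlow : / 2 ^ S (S p) * t ^ 2 <= (w + t) ^ S (S p)).
{ apply Rle_trans with ((t / 2) ^ S (S p)); [|apply pow_incr; lra].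
  unfold Rdiv. rewrite Rpow_mult_distr, pow_inv, (Rmult_comm (t ^ _)).
  apply Rmult_le_compat_l.
  - apply Rlt_le, Rinv_0_lt_compat, pow_lt. lra.
  - apply Rle_pow; [lra | lia]. }
assert (H2 : 0 < 2 ^ S (S p)) by (apply pow_lt; lra).
assert (Ht2 : 0 < t ^ 2) by (apply pow_lt; lra).
assert (Hinv : / (w + t) ^ S (S p) <= 2 ^ S (S p) * / t ^ 2).
{ replace (2 ^ S (S p) * / t ^ 2) with (/ (/ 2 ^ S (S p) * t ^ 2))
    by (field; split; lra).
  apply Rinv_le_contravar; [|exact Hlow].
  apply Rmult_lt_0_compat; [apply Rinv_0_lt_compat|]; assumption. }
replace (INR (fact (S p)) * 2 ^ S (S p) * (Rabs b * / t))
  with (1 * INR (fact (S p)) * Rabs b * t * (2 ^ S (S p) * / t ^ 2))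
  by (field; lra).
apply Rmult_le_compat_l; [|exact Hinv].
pose proof (Rabs_pos b). repeat apply Rmult_le_pos; lra.
Qed.

Definition dbser (x : R) (p : nat) (w : R) : R :=
  match p with O => 1 | S _ => 0 end + Series (fun k => dbterm x p k w).

Lemma is_derive_dbser (x : R) (p : nat) (w : R) : bin_summable x ->
  Rabs w < 1 / 2 -> is_derive (dbser x p) w (dbser x (S p) w).
Proof.
intros Hx Hw.
assert (Hball : forall y, Rabs (y - w) < 1 / 2 - Rabs w -> Rabs y < 1 / 2).
{ intros y Hy. replace y with (y - w + w) by ring.
  pose proof (Rabs_triang (y - w) w). lra. }
assert (Hs : forall q y, Rabs y < 1 / 2 -> ex_series (fun k => dbterm x q k y)).
{ intros [|q] y Hy.
  - apply ex_series_bterm; [exact Hx|]. apply Rabs_lt_between in Hy. lra.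
  - destruct (ex_series_dbterm_bound x q Hx) as [M [HM HB]].
    apply ex_series_dominated with (2 := HM). intro k. now apply HB. }
destruct (ex_series_dbterm_bound x (S p) Hx) as [M [HM HB]].
unfold dbser at 2.
apply (is_derive_plus (fun _ => match p with O => 1 | S _ => 0 end)
         (fun w => Series (fun k => dbterm x p k w)) w 0).
- apply (is_derive_const (match p with O => 1 | S _ => 0 end) w).
- apply (is_derive_Series (dbterm x p) (dbterm x (S p)) (dbterm x (S (S p))) M w
           (1 / 2 - Rabs w)).
  + lra.
  + intros k y Hy. apply Hball, Rabs_lt_between in Hy.
    apply is_derive_dbterm. lra.
  + intros k y Hy. apply Hball, Rabs_lt_between in Hy.
    apply is_derive_dbterm. lra.
  + intros k y Hy. apply HB, Hball, Hy.
  + exact HM.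
  + intros y Hy. apply Hs, Hball, Hy.
  + apply Hs, Hw.
Qed.

Lemma Derive_n_bser (x : R) (p : nat) (w : R) : bin_summable x ->
  Rabs w < 1 / 2 -> Derive_n (bser x) p w = dbser x p w.
Proof.
intros Hx. revert w. induction p as [|p IH]; intros w Hw; [reflexivity|].
cbn [Derive_n].
rewrite (Derive_ext_loc _ (dbser x p)).
- now apply is_derive_unique, is_derive_dbser.
- assert (H : 0 < 1 / 2 - Rabs w) by lra.
  exists (mkposreal _ H). intros y Hy. apply IH.
  change (Rabs (y - w) < 1 / 2 - Rabs w) in Hy. change R in y.
  replace y with (y - w + w) by ring.
  pose proof (Rabs_triang (y - w) w). lra.
Qed.

Lemma dzGammaQuot_series (m n : nat) (e : R) : (1 <= m)%nat -> Rabs e <= 1 / 30 ->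
  dzGammaQuot m (INR n + e) 1
  = - (-1) ^ m * INR (fact m)
    * Series (fun k => sbin (INR n + e) (S k) / INR (S k) ^ m).
Proof.
intros Hm He. unfold dzGammaQuot.
(* Derivatives at 1 need the identity only near [z = 1]; the series variable is [z - 1]. *)
rewrite (Derive_n_ext_loc _ (fun w => bser (INR n + e) (w + -1))).
- rewrite Derive_n_comp_trans. replace (1 + -1) with 0 by ring.
  rewrite Derive_n_bser.
  + unfold dbser. destruct m as [|m]; [lia|]. rewrite Rplus_0_l.
    rewrite <- Series_scal_l. apply Series_ext. intro k. unfold dbterm.
    pose proof (INR_S_pos k). rewrite Rplus_0_l.
    change (INR (S k) ^ S (S m)) with (INR (S k) * INR (S k) ^ S m).
    assert (INR (S k) ^ S m <> 0) by (apply pow_nonzero; lra).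
    set (t := INR (S k)) in *. field. split; [assumption | lra].
  + now apply bin_summable_near_nat.
  + rewrite Rabs_R0. lra.
- assert (H : 0 < 1 / 2) by lra.
  exists (mkposreal _ H). intros w Hw. change (Rabs (w - 1) < 1 / 2) in Hw.
  change R in w.
  rewrite bser_Gamma by assumption.
  replace (w + -1 + 1) with w by ring.
  replace (w + -1 + (INR n + e) + 1) with (w + (INR n + e)) by ring.
  reflexivity.
Qed.

(** * Head and tail of the series as functions of e *)

Definition tail_weight (m n j : nat) : R :=
  / (Binomial.C (n + j) j * INR (n + j + 1) ^ (m + 1)).

(** Here [p] is the order of differentiation in [e]. Of the power [m + 1] in the weight, [m] comes
    from the series for the derivative in [z] and 1 from [sbin_tail]. *)
Definition tail_series (m n p : nat) (e : R) : R :=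
  Series (fun j => dprod hcoef j p e * tail_weight m n j).

Definition head_sum (m n p : nat) (e : R) : R :=
  sum_n_m (fun k => (-1) ^ k * Binomial.C n k / INR k ^ m
                    * dprod (pcoef n) k p e) 1 n.

Lemma tail_weight_bound (m n j : nat) : (1 <= m)%nat ->
  0 < tail_weight m n j <= / INR (S j) ^ 2.
Proof.
intro Hm. unfold tail_weight. pose proof (C_diag_ge1 n j).
assert (1 <= INR (S j)) by (apply (le_INR 1); lia).
assert (INR (S j) <= INR (n + j + 1)) by (apply le_INR; lia).
assert (H2 : 0 < INR (S j) ^ 2) by (apply pow_lt; lra).
assert (H3 : INR (S j) ^ 2 <= INR (n + j + 1) ^ (m + 1)).
{ apply Rle_trans with (INR (n + j + 1) ^ 2); [apply pow_incr; lra|].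
  apply Rle_pow; [lra | lia]. }
split.
- apply Rinv_0_lt_compat. nra.
- apply Rinv_le_contravar; nra.
Qed.

Lemma tail_series_term_bound (m n p j : nat) (e : R) : (1 <= m)%nat -> (p <= 3)%nat ->
  Rabs e <= 1 / 30 ->
  Rabs (dprod hcoef j p e * tail_weight m n j) <= 27000 * (hmaj j / INR (S j) ^ 2).
Proof.
intros Hm Hp He. destruct (tail_weight_bound m n j Hm) as [W0 W1].
pose proof (dprod_hcoef_bound j p e He Hp) as B.
rewrite Rabs_mult, (Rabs_right (tail_weight m n j)) by lra.
unfold Rdiv. rewrite <- Rmult_assoc.
apply Rmult_le_compat; try lra. apply Rabs_pos.
Qed.

Lemma ex_series_tail_series (m n p : nat) (e : R) : (1 <= m)%nat -> (p <= 3)%nat ->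
  Rabs e <= 1 / 30 -> ex_series (fun j => dprod hcoef j p e * tail_weight m n j).
Proof.
intros Hm Hp He.
apply ex_series_dominated with (fun j => 27000 * (hmaj j / INR (S j) ^ 2)).
- intro j. now apply tail_series_term_bound.
- exact (ex_series_scal 27000 _ ex_series_hmaj).
Qed.

(** Termwise differentiation at order [p] needs a majorant at order [p + 2], and the product bounds
    reach order 3. *)
Lemma is_derive_tail_series (m n p : nat) (e : R) : (1 <= m)%nat -> (p <= 1)%nat ->
  Rabs e < 1 / 30 -> is_derive (tail_series m n p) e (tail_series m n (S p) e).
Proof.
intros Hm Hp He.
assert (Hball : forall y, Rabs (y - e) < 1 / 30 - Rabs e -> Rabs y <= 1 / 30).
{ intros y Hy. replace y with (y - e + e) by ring.
  pose proof (Rabs_triang (y - e) e). lra. }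
assert (Hd : forall q j y, is_derive (fun y => dprod hcoef j q y * tail_weight m n j) y
                             (dprod hcoef j (S q) y * tail_weight m n j)).
{ intros q j y.
  apply (is_derive_ext (fun y => tail_weight m n j * dprod hcoef j q y));
    [intro; apply Rmult_comm|].
  rewrite (Rmult_comm _ (tail_weight m n j)).
  apply (is_derive_scal (dprod hcoef j q)), is_derive_dprod. }
apply (is_derive_Series (fun j y => dprod hcoef j p y * tail_weight m n j)
  (fun j y => dprod hcoef j (S p) y * tail_weight m n j)
  (fun j y => dprod hcoef j (S (S p)) y * tail_weight m n j)
  (fun j => 27000 * (hmaj j / INR (S j) ^ 2)) e (1 / 30 - Rabs e)).
- lra.
- intros; apply Hd.
- intros; apply Hd.
- intros j y Hy. apply tail_series_term_bound; [exact Hm | lia | now apply Hball].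
- exact (ex_series_scal 27000 _ ex_series_hmaj).
- intros y Hy. apply ex_series_tail_series; [exact Hm | lia | now apply Hball].
- apply ex_series_tail_series; [exact Hm | lia | lra].
Qed.

Lemma is_derive_head_sum (m n p : nat) (e : R) :
  is_derive (head_sum m n p) e (head_sum m n (S p) e).
Proof.
unfold head_sum.
assert (H : forall a N, is_derive
    (fun y => sum_n_m (fun k => a k * dprod (pcoef n) k p y) 1 N) e
    (sum_n_m (fun k => a k * dprod (pcoef n) k (S p) e) 1 N)).
{ intro a. induction N as [|N IH].
  - rewrite sum_n_m_zero by lia.
    apply (is_derive_ext (fun _ => 0)).
    + intro y. now rewrite sum_n_m_zero by lia.
    + apply (is_derive_const 0 e).
  - rewrite sum_n_Sm by lia.
    apply (is_derive_ext (fun y =>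
      sum_n_m (fun k => a k * dprod (pcoef n) k p y) 1 N
      + a (S N) * dprod (pcoef n) (S N) p y)).
    + intro y. now rewrite sum_n_Sm by lia.
    + apply (is_derive_plus
        (fun y => sum_n_m (fun k => a k * dprod (pcoef n) k p y) 1 N)
        (fun y => a (S N) * dprod (pcoef n) (S N) p y)); [exact IH|].
      apply (is_derive_scal (dprod (pcoef n) (S N) p)), is_derive_dprod. }
apply H.
Qed.

(** * Derivatives in x at n *)

(** The factor [e] of the tail is kept outside the series, so that at [e = 0] each derivative in [x]
    costs the tail one derivative fewer. *)
Definition local_form (m n : nat) (e : R) : R :=
  - (-1) ^ m * INR (fact m)
  * (head_sum m n 0 e - (-1) ^ n * (e * (dprod (pcoef n) n 0 e * tail_series m n 0 e))).

Definition dlocal_form (m n : nat) (e : R) : R :=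
  - (-1) ^ m * INR (fact m)
  * (head_sum m n 1 e
     - (-1) ^ n * (dprod (pcoef n) n 0 e * tail_series m n 0 e
                   + e * (dprod (pcoef n) n 1 e * tail_series m n 0 e
                          + dprod (pcoef n) n 0 e * tail_series m n 1 e))).

Lemma dzGammaQuot_local (m n : nat) (e : R) : (1 <= m)%nat -> Rabs e <= 1 / 30 ->
  dzGammaQuot m (INR n + e) 1 = local_form m n e.
Proof.
intros Hm He. rewrite dzGammaQuot_series by assumption. unfold local_form. f_equal.
assert (Hs : ex_series (fun k => sbin (INR n + e) (S k) / INR (S k) ^ m)).
{ destruct (bin_summable_near_nat n e He) as [Hs _].
  apply ex_series_dominated with (2 := Hs). intro k.
  assert (1 <= INR (S k)) by (apply (le_INR 1); lia).
  unfold Rdiv. rewrite Rabs_mult. apply Rmult_le_compat_l; [apply Rabs_pos|].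
  assert (INR (S k) <= INR (S k) ^ m).
  { rewrite <- (pow_1 (INR (S k))) at 1. now apply Rle_pow. }
  rewrite Rabs_right.
  - apply Rinv_le_contravar; lra.
  - apply Rle_ge, Rlt_le, Rinv_0_lt_compat. lra. }
rewrite (Series_split_first _ n Hs). unfold Rminus. f_equal.
- unfold head_sum. apply sum_n_m_ext_loc. intros k Hk.
  replace (S (k - 1)) with k by lia. rewrite sbin_head by lia.
  unfold Rdiv.
  (* The extensionality lemma states the equality over the carrier of an abstract monoid; [ring]
     needs it over [R]. *)
  match goal with |- @eq _ ?a ?b => change (@eq R a b) end. ring.
- unfold tail_series.
  replace (- ((-1) ^ n * (e * (dprod (pcoef n) n 0 e *
      Series (fun j => dprod hcoef j 0 e * tail_weight m n j)))))
    with (- (-1) ^ n * e * dprod (pcoef n) n 0 e *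
      Series (fun j => dprod hcoef j 0 e * tail_weight m n j)) by ring.
  rewrite <- Series_scal_l. apply Series_ext. intro j.
  rewrite sbin_tail. unfold tail_weight.
  replace (S (n + j)) with (n + j + 1)%nat by lia.
  pose proof (C_diag_ge1 n j). assert (0 < INR (n + j + 1)) by (apply lt_0_INR; lia).
  rewrite (pow_add _ m 1), pow_1.
  assert (INR (n + j + 1) ^ m <> 0) by (apply pow_nonzero; lra).
  field. repeat split; auto; lra.
Qed.

(** [auto_derive] leaves eta-expanded derivatives, and rewriting needs this syntactic form. *)
Lemma Derive_eta (f : R -> R) (x l : R) :
  is_derive f x l -> Derive (fun y : R => f y) x = l.
Proof. exact (is_derive_unique f x l). Qed.

Lemma is_derive_local_form (m n : nat) (e : R) : (1 <= m)%nat ->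
  Rabs e < 1 / 30 -> is_derive (local_form m n) e (dlocal_form m n e).
Proof.
intros Hm He. unfold local_form, dlocal_form.
pose proof (is_derive_head_sum m n 0 e) as Dh.
pose proof (is_derive_dprod (pcoef n) n 0 e) as Dp.
pose proof (is_derive_tail_series m n 0 e Hm ltac:(lia) He) as Ds.
auto_derive.
- repeat split; auto; eexists; eassumption.
- rewrite (Derive_eta _ _ _ Dh), (Derive_eta _ _ _ Dp), (Derive_eta _ _ _ Ds).
  ring.
Qed.

(** The second derivative of [e g(e)] at 0 is [2 g'(0)], with [g] the product times the tail
    series. *)
Lemma is_derive_dlocal_form_0 (m n : nat) : (1 <= m)%nat ->
  is_derive (dlocal_form m n) 0
    (- (-1) ^ m * INR (fact m)
     * (head_sum m n 2 0
        - (-1) ^ n * (2 * (dprod (pcoef n) n 1 0 * tail_series m n 0 0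
                           + dprod (pcoef n) n 0 0 * tail_series m n 1 0)))).
Proof.
intros Hm. assert (He : Rabs 0 < 1 / 30) by (rewrite Rabs_R0; lra).
unfold dlocal_form.
pose proof (is_derive_head_sum m n 1 0) as Dh.
pose proof (is_derive_dprod (pcoef n) n 0 0) as Dp.
pose proof (is_derive_dprod (pcoef n) n 1 0) as Dp1.
pose proof (is_derive_tail_series m n 0 0 Hm ltac:(lia) He) as Ds.
pose proof (is_derive_tail_series m n 1 0 Hm ltac:(lia) He) as Ds1.
auto_derive.
- repeat split; auto; eexists; eassumption.
- rewrite (Derive_eta _ _ _ Dh), (Derive_eta _ _ _ Dp), (Derive_eta _ _ _ Dp1),
    (Derive_eta _ _ _ Ds), (Derive_eta _ _ _ Ds1).
  ring.
Qed.

Lemma Derive_n_dzGammaQuot (m n p : nat) : (1 <= m)%nat ->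
  Derive_n (fun x => dzGammaQuot m x 1) p (INR n) = Derive_n (local_form m n) p 0.
Proof.
intro Hm.
rewrite (Derive_n_ext_loc _ (fun x => local_form m n (x + - INR n))).
- rewrite Derive_n_comp_trans. f_equal. ring.
- assert (H : 0 < 1 / 30) by lra.
  exists (mkposreal _ H). intros x Hx. change (Rabs (x - INR n) < 1 / 30) in Hx.
  change R in x. rewrite <- dzGammaQuot_local; [|assumption|].
  + do 2 f_equal. ring.
  + unfold Rminus in Hx. lra.
Qed.

(** * Harmonic numbers as derivatives of products at 0 *)

Lemma gharm_S (s n : nat) : gharm s (S n) = gharm s n + / INR (S n) ^ s.
Proof. unfold gharm. now rewrite sum_n_Sm by lia. Qed.

Lemma dprod_at_0 (c : nat -> R) (k : nat) :
  dprod c k 0 0 = 1 /\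
  dprod c (S k) 1 0 = dprod c k 1 0 + c k /\
  dprod c (S k) 2 0 = dprod c k 2 0 + 2 * c k * dprod c k 1 0.
Proof.
assert (H : dprod c k 0 0 = 1).
{ induction k as [|k IH]; [reflexivity|]. cbn [dprod]. rewrite IH.
  change (INR 0) with 0. ring. }
repeat split; [exact H | |]; cbn [dprod].
- change (1 - 1)%nat with 0%nat. rewrite H. simpl. ring.
- change (2 - 1)%nat with 1%nat. simpl. ring.
Qed.

Lemma dprod_hcoef_at_0 (k : nat) : dprod hcoef k 1 0 = - harm k.
Proof.
induction k as [|k IH].
- unfold harm, gharm. rewrite sum_n_m_zero by lia. simpl. unfold zero; simpl. ring.
- destruct (dprod_at_0 hcoef k) as [_ [H _]]. rewrite H, IH.
  unfold harm. rewrite gharm_S, pow_1. unfold hcoef. ring.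
Qed.

(** At 0 a product of factors [1 + c_i x] has first derivative the sum of the [c_i], and second
    derivative the square of that sum minus the sum of the [c_i^2]; here [c_i = 1/(n-i)] for
    [i < k]. *)
Lemma dprod_pcoef_at_0 (n k : nat) : (k <= n)%nat ->
  dprod (pcoef n) k 1 0 = harm n - harm (n - k) /\
  dprod (pcoef n) k 2 0
  = (harm n - harm (n - k)) ^ 2 - (gharm 2 n - gharm 2 (n - k)).
Proof.
induction k as [|k IH]; intro Hk.
- rewrite Nat.sub_0_r. simpl. split; ring.
- destruct IH as [H1 H2]; [lia|].
  destruct (dprod_at_0 (pcoef n) k) as [_ [E1 E2]]. rewrite E1, E2, H1, H2.
  unfold pcoef, harm. replace (n - k)%nat with (S (n - S k)) by lia.
  rewrite !gharm_S, pow_1. pose proof (INR_S_pos (n - S k)).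
  set (t := INR (S (n - S k))) in *. split; field; lra.
Qed.

Lemma sum_n_m_lincomb (a b c : nat -> R) (t : R) (N : nat) :
  (forall k, (1 <= k <= N)%nat -> a k = t * b k - c k) ->
  sum_n_m a 1 N = t * sum_n_m b 1 N - sum_n_m c 1 N.
Proof.
induction N as [|N IH]; intro H.
- rewrite !sum_n_m_zero by lia. unfold zero; simpl. ring.
- rewrite !sum_n_Sm by lia. rewrite IH by (intros; apply H; lia).
  rewrite H by lia. unfold plus; simpl. ring.
Qed.

Theorem theorem3p1 (m n : nat) (hm : (1 <= m)%nat) :
  is_series
    (fun k : nat =>
       harm k / (INR (n + k + 1) ^ (m + 1) * binom (INR (n + k)) (INR k)))
    ((-1) ^ n / 2 *
       sum_n_m (fun k : nat =>
         (-1) ^ (k - 1) / INR k ^ m * binom (INR n) (INR k) *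
         (harm (n - k) ^ 2 + gharm 2 (n - k) - gharm 2 n - harm n ^ 2)) 1 n
     - (-1) ^ (m + n) / (2 * INR (fact m)) *
         Derive_n (fun x => dzGammaQuot m x 1) 2 (INR n)
     + (-1) ^ (m + n) * harm n / INR (fact m) *
         Derive (fun x => dzGammaQuot m x 1) (INR n)).
Proof.
assert (He : Rabs 0 <= 1 / 30) by (rewrite Rabs_R0; lra).
change (Derive (fun x => dzGammaQuot m x 1) (INR n))
  with (Derive_n (fun x => dzGammaQuot m x 1) 1 (INR n)).
rewrite !Derive_n_dzGammaQuot by assumption.
assert (D1 : forall e, Rabs e < 1 / 30 ->
             Derive_n (local_form m n) 1 e = dlocal_form m n e).
{ intros e Hlt. now apply is_derive_unique, is_derive_local_form. }
assert (D2 := is_derive_unique _ _ _ (is_derive_dlocal_form_0 m n hm)).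
replace (Derive_n (local_form m n) 2 0) with (Derive (dlocal_form m n) 0).
2: { symmetry. apply Derive_ext_loc. assert (H : 0 < 1 / 30) by lra.
     exists (mkposreal _ H). intros y Hy. change (Rabs (y - 0) < 1 / 30) in Hy.
     rewrite Rminus_0_r in Hy. now apply D1. }
rewrite D1 by (rewrite Rabs_R0; lra). rewrite D2. unfold dlocal_form.
destruct (dprod_at_0 (pcoef n) n) as [P0 _].
destruct (dprod_pcoef_at_0 n n (Nat.le_refl n)) as [P1 _].
rewrite P0, P1, Nat.sub_diag.
replace (harm 0) with 0
  by (unfold harm, gharm; rewrite sum_n_m_zero by lia; reflexivity).
(* With [d1], [d2] the first two derivatives of the head product at 0, the harmonic bracket equals
   [d2 - 2 H_n d1]; its sign is absorbed by [(-1)^(k-1) = - (-1)^k]. *)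
rewrite (sum_n_m_lincomb _
  (fun k => (-1) ^ k * Binomial.C n k / INR k ^ m * dprod (pcoef n) k 1 0)
  (fun k => (-1) ^ k * Binomial.C n k / INR k ^ m * dprod (pcoef n) k 2 0)
  (2 * harm n)).
2: { intros k Hk. rewrite binom_nat by lia.
     destruct (dprod_pcoef_at_0 n k) as [E1 E2]; [lia|]. rewrite E1, E2.
     replace ((-1) ^ k) with (- (-1) ^ (k - 1))
       by (replace k with (S (k - 1)) at 2 by lia; simpl; ring).
     unfold Rdiv. ring. }
fold (head_sum m n 1 0). fold (head_sum m n 2 0).
assert (Hsq : forall p, (-1) ^ p * (-1) ^ p = 1).
{ intro p. rewrite <- Rpow_mult_distr.
  replace (-1 * -1) with 1 by ring. apply pow1. }
pose proof (INR_fact_lt_0 m) as Hf.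
(* All head sums cancel, and so do the two terms [H_n * tail_series m n 0 0]. The remaining series
   has weights [H_k], since the first derivative of the [hcoef] product at 0 is [- H_k]. *)
match goal with |- is_series _ ?l => replace l with (- tail_series m n 1 0) end.
2: { rewrite pow_add. pose proof (Hsq m) as Sm. pose proof (Hsq n) as Sn.
     set (s := (-1) ^ n) in *. set (u := (-1) ^ m) in *.
     set (F := INR (fact m)) in *.
     set (h0 := tail_series m n 0 0). set (h1 := tail_series m n 1 0).
     set (f1 := head_sum m n 1 0). set (f2 := head_sum m n 2 0). set (H := harm n).
     (* The squares of the signs are displayed so that they can be replaced by 1, which [field]
        alone would not know. *)
     transitivity (s / 2 * (2 * H * f1 - f2)
       + (u * u) * s / 2 * f2 - (u * u) * (s * s) * ((H - 0) * h0 + 1 * h1)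
       - (u * u) * s * H * f1 + (u * u) * (s * s) * H * h0).
     - rewrite Sm, Sn. field.
     - field. lra. }
apply is_series_ext_R with (fun j => -1 * (dprod hcoef j 1 0 * tail_weight m n j)).
- intro k. rewrite dprod_hcoef_at_0, binom_nat by lia. unfold tail_weight, Rdiv.
  rewrite (Rmult_comm (INR _ ^ _)). ring.
- replace (- tail_series m n 1 0) with (-1 * tail_series m n 1 0) by ring.
  exact (is_series_scal (-1) _ _
    (Series_correct _ (ex_series_tail_series m n 1 0 hm ltac:(lia) He))).
Qed.
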